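(* Let $\mathcal G$ be a groupoid (in the sense of the standing conventions below). Let $M\in\mathbb N$ and let $(\epsilon_n)_{n\in\mathbb N}$ be a decreasing sequence of positive numbers with $\lim_{n\to\infty}\epsilon_n=0$. Suppose $\mathcal G$ admits a Følner sequence $\mathcal S=(S_n)_{n\in\mathbb N}$ such that, for every $n$, the normal set $S_n$ is $(M,\epsilon_n)$-good and has $1$-controlled height. Then $\mathcal G$ is almost finite in measure.
   Context: Standing conventions: a groupoid $\mathcal G$ is a $\sigma$-compact, locally compact, Hausdorff, étale groupoid which is ample (its topology has a basis of compact open bisections) and whose unit space $\mathcal G^{(0)}$ is compact; $s,r$ denote source and range. For subsets $A,B\subseteq\mathcal G$, $AB=\{ab: a\in A, b\in B, s(a)=r(b)\}$, and for $u\in\mathcal G^{(0)}$, $Au=\{a\in A: s(a)=u\}$. A bisection is a set on which $s$ and $r$ are injective (an open bisection is open with $s,r$ restricting to homeomorphisms onto open sets). A multisection is a finite family $\{C_{i,j}: i,j\in F\}$ of bisections with $C_{i,j}C_{j,k}=C_{i,k}$ for all $i,j,k\in F$ and with $\{C_{i,i}:i\in F\}$ a pairwise disjoint family of subsets of $\mathcal G^{(0)}$ (the levels); it is compact open if all $C_{i,j}$ are. A castle is a finite family of multisections $\{C^l_{i,j}: i,j\in F_l\}$, $l\in I$, with $C^l_{i,j}C^{l'}_{i',j'}=\emptyset$ whenever $l\neq l'$. A compact open subgroupoid $\mathcal H$ is elementary if $\mathcal H=\bigsqcup_{l\in I}\bigsqcup_{i,j\in F_l}C^l_{i,j}$ for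 some compact open castle; then $\mathcal H^{(0)}$ is the union of its levels. $M(\mathcal G)$ is the set of $\mathcal G$-invariant Borel probability measures on $\mathcal G^{(0)}$ (i.e. $\mu(s(B))=\mu(r(B))$ for every compact open bisection $B$). Conventions: $\inf_\emptyset=+\infty$, $\sup_\emptyset=0$. For compact $K\subseteq\mathcal G$ and $\epsilon>0$, a finite nonempty $F\subseteq\mathcal G$ is $(K,\epsilon)$-Følner if $|KF\setminus F|\le\epsilon|F|$. A normal set is a compact open $S\subseteq\mathcal G$ together with compact open multisections $\mathcal C_l=\{C^l_{i,j}:i,j\in F_l\}$, $l=1,\dots,m$, and chosen indices $i_l\in F_l$, such that $S=\bigcup_{l=1}^m\bigsqcup_{i\in F_l}C^l_{i,i_l}$ and $\mathcal G^{(0)}=\bigsqcup_{l=1}^m C^l_{i_l,i_l}$ (disjoint union). It is a normal $(K,\epsilon)$-Følner set if in addition $Su$ is $(K,\epsilon)$-Følner for every $u\in\mathcal G^{(0)}$. A Følner sequence for $\mathcal G$ is a sequence $(S_n)$ of normal sets such that for every compact $K\subseteq\mathcal G$, $\sup_{u\in\mathcal G^{(0)}}|KS_nu\setminus S_nu|/|S_nu|\to0$ as $n\to\infty$. For a normal set $S$ with the structure above, its height is $h(S)=\min_{1\le l\le m}|F_l|$. It has $N$-controlled height ($N\in\mathbb N_+$) if $|F_l|\le N\,h(S)$ for all $l$. It is $(M,\epsilon)$-good if there are injections $f_l:\{0,\dots,h(S)-1\}\to F_l$ ($1\le l\le m$) with $f_l(0)=i_l$ such that: (a) $\inf_{\mu\in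 M(\mathcal G)}\mu\big(\bigcup_{l=1}^m C^l_{f_l(k),f_l(k)}\big)\ge1-\epsilon$ for every $0\le k\le h(S)-1$; and (b) there is $L\subseteq\{1,\dots,m\}$ with $\inf_{\mu\in M(\mathcal G)}\mu\big(\bigsqcup_{l\in L}C^l_{i_l,i_l}\big)>1-\epsilon$ such that for every $0\le k\le h(S)-1$ the family $\{C^l_{f_l(k),f_l(k)}: l\in L\}$ can be written as a union of at most $M$ subfamilies each consisting of pairwise disjoint sets. $\mathcal G$ is almost finite in measure if for every compact $K\subseteq\mathcal G$ and $\epsilon>0$ there is a compact open elementary subgroupoid $\mathcal H$ with $|K\mathcal Hu\setminus\mathcal Hu|<\epsilon|\mathcal Hu|$ for every $u\in\mathcal H^{(0)}$ and $\mu(\mathcal H^{(0)})>1-\epsilon$ for every $\mu\in M(\mathcal G)$. *)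

(* Defs.v *)
From mathcomp Require Import all_boot all_order all_algebra.
From mathcomp Require Import all_classical all_reals all_analysis.
From mathcomp Require Import finmap.

Set Implicit Arguments.
Unset Strict Implicit.
Unset Printing Implicit Defensive.

Import Order.TTheory GRing.Theory Num.Theory.
Local Open Scope classical_set_scope.
Local Open Scope ring_scope.

Section Groupoid.
Context (G : ptopologicalType) (s r : G -> G) (mul : G -> G -> G) (inv : G -> G).

Definition groupoid_axioms : Prop :=
  [/\ (forall a, s (s a) = s a /\ r (s a) = s a /\ s (r a) = r a /\ r (r a) = r a),
      (forall a b, s a = r b -> s (mul a b) = s b /\ r (mul a b) = r a),
      (forall a b c, s a = r b -> s b = r c -> mul (mul a b) c = mul a (mul b c)),
      (forall a, mul (r a) a = a /\ mul a (s a) = a) &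
      (forall a, s (inv a) = r a /\ r (inv a) = s a /\
                 mul a (inv a) = r a /\ mul (inv a) a = s a)].

Definition G0 : set G := range s.

Definition setmul (A B : set G) : set G :=
  [set x | exists a b, [/\ A a, B b, s a = r b & x = mul a b]].

Definition fib (A : set G) (u : G) : set G := [set a | A a /\ s a = u].

Definition bisection (B : set G) : Prop :=
  (forall x y, B x -> B y -> s x = s y -> x = y) /\
  (forall x y, B x -> B y -> r x = r y -> x = y).

(** open bisection: open, and s, r restrict to homeomorphisms onto open sets
    (s, r are continuous; the restrictions are injective open maps). *)
Definition open_bisection (B : set G) : Prop :=
  [/\ open B, bisection B &
      forall U, open U -> U `<=` B -> open (s @` U) /\ open (r @` U)].

Definition compact_open_bisection (B : set G) : Prop :=
  compact B /\ open_bisection B.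

Definition ample_groupoid : Prop :=
  groupoid_axioms /\
  [/\ [/\ continuous s, continuous r, continuous inv &
          {within [set p : G * G | s p.1 = r p.2],
             continuous (fun p : G * G => mul p.1 p.2)}],
      [/\ hausdorff_space G, locally_compact [set: G] &
          (exists K : nat -> set G, (forall n, compact (K n)) /\
                                   \bigcup_n K n = [set: G])],
      (forall x : G, exists B, open_bisection B /\ B x),
      (forall (x : G) (U : set G), open U -> U x ->
          exists B, [/\ compact_open_bisection B, B x & B `<=` U]) &
      compact G0].

Definition card (A : set G) : nat := (#|` fset_set A|)%fset.

Definition multisection (k : nat) (C : nat -> nat -> set G) : Prop :=
  [/\ (forall i j, (i < k)%N -> (j < k)%N -> bisection (C i j)),
      (forall i j l, (i < k)%N -> (j < k)%N -> (l < k)%N ->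
          setmul (C i j) (C j l) = C i l),
      (forall i, (i < k)%N -> C i i `<=` G0) &
      (forall i j, (i < k)%N -> (j < k)%N -> i <> j -> C i i `&` C j j = set0)].

Definition compact_open_multisection (k : nat) (C : nat -> nat -> set G) : Prop :=
  multisection k C /\
  (forall i j, (i < k)%N -> (j < k)%N -> compact (C i j) /\ open (C i j)).

Definition compact_open_castle (m : nat) (k : nat -> nat)
    (C : nat -> nat -> nat -> set G) : Prop :=
  (forall l, (l < m)%N -> compact_open_multisection (k l) (C l)) /\
  (forall l l' i j i' j', (l < m)%N -> (l' < m)%N -> l <> l' ->
      (i < k l)%N -> (j < k l)%N -> (i' < k l')%N -> (j' < k l')%N ->
      setmul (C l i j) (C l' i' j') = set0).

Definition subgroupoid (H : set G) : Prop :=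
  (forall a b, H a -> H b -> s a = r b -> H (mul a b)) /\
  (forall a, H a -> H (inv a)).

Definition unitspace (H : set G) : set G := H `&` G0.

Definition elementary (H : set G) : Prop :=
  [/\ compact H, open H, subgroupoid H &
      (exists m k C, [/\ compact_open_castle m k C,
        H = \bigcup_(l in [set l | (l < m)%N])
              \bigcup_(p in [set p : nat * nat | (p.1 < k l)%N /\ (p.2 < k l)%N])
                 C l p.1 p.2 &
        forall l l' i j i' j', (l < m)%N -> (l' < m)%N ->
          (i < k l)%N -> (j < k l)%N -> (i' < k l')%N -> (j' < k l')%N ->
          (l, i, j) <> (l', i', j') -> C l i j `&` C l' i' j' = set0])].

(** Data of a normal set: m multisections, the l-th indexed by
    F_l = {0,..,k l - 1}, with chosen indices i0 l in F_l. *)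
Record normal_data := NormalData {
  nd_m : nat;
  nd_k : nat -> nat;
  nd_C : nat -> nat -> nat -> set G;
  nd_i0 : nat -> nat }.

Definition nd_set (D : normal_data) : set G :=
  \bigcup_(l in [set l | (l < nd_m D)%N])
     \bigcup_(i in [set i | (i < nd_k D l)%N]) nd_C D l i (nd_i0 D l).

Definition normal_set (S : set G) (D : normal_data) : Prop :=
  [/\ compact S /\ open S,
      (forall l, (l < nd_m D)%N -> compact_open_multisection (nd_k D l) (nd_C D l)),
      (forall l, (l < nd_m D)%N -> (nd_i0 D l < nd_k D l)%N),
      S = nd_set D &
   [/\
      (forall l i j, (l < nd_m D)%N -> (i < nd_k D l)%N -> (j < nd_k D l)%N ->
          i <> j -> nd_C D l i (nd_i0 D l) `&` nd_C D l j (nd_i0 D l) = set0),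
      G0 = \bigcup_(l in [set l | (l < nd_m D)%N]) nd_C D l (nd_i0 D l) (nd_i0 D l) &
      (forall l l', (l < nd_m D)%N -> (l' < nd_m D)%N -> l <> l' ->
          nd_C D l (nd_i0 D l) (nd_i0 D l) `&` nd_C D l' (nd_i0 D l') (nd_i0 D l') = set0)]].

Definition height (D : normal_data) : nat :=
  \big[minn/nd_k D 0]_(l < nd_m D) nd_k D l.

Definition controlled_height (N : nat) (D : normal_data) : Prop :=
  forall l, (l < nd_m D)%N -> (nd_k D l <= N * height D)%N.

Definition BorelG := g_sigma_algebraType (@open G).

Context (R : realType).

(** G-invariant Borel probability measures on G^(0) (probability measures on
    the Borel sets of G, concentrated on the closed set G^(0)). *)
Definition invariant_measures : set (probability BorelG R) :=
  [set mu | mu (G0 : set BorelG) = 1%E /\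
            forall B, compact_open_bisection B ->
              mu (s @` B : set BorelG) = mu (r @` B : set BorelG)].

Definition inf_measure (A : set G) : \bar R :=
  ereal_inf [set mu (A : set BorelG) | mu in invariant_measures].

Definition good (M : nat) (eps : R) (D : normal_data) : Prop :=
  exists f : nat -> nat -> nat,
  [/\ (forall l, (l < nd_m D)%N ->
         [/\ forall t, (t < height D)%N -> (f l t < nd_k D l)%N,
             forall t t', (t < height D)%N -> (t' < height D)%N ->
                f l t = f l t' -> t = t' &
             f l 0 = nd_i0 D l]),
      (forall t, (t < height D)%N ->
         ((1 - eps)%:E <= inf_measure
           (\bigcup_(l in [set l | (l < nd_m D)%N]) nd_C D l (f l t) (f l t)))%E) &
      (exists L : set nat, [/\ L `<=` [set l | (l < nd_m D)%N],
        ((1 - eps)%:E < inf_measure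
           (\bigcup_(l in L) nd_C D l (nd_i0 D l) (nd_i0 D l)))%E &
        forall t, (t < height D)%N ->
          exists c : nat -> nat,
            (forall l, L l -> (c l < M)%N) /\
            (forall l l', L l -> L l' -> l <> l' -> c l = c l' ->
               nd_C D l (f l t) (f l t) `&` nd_C D l' (f l' t) (f l' t) = set0)])].

Definition folner_sequence (S : nat -> set G) (D : nat -> normal_data) : Prop :=
  (forall n, normal_set (S n) (D n)) /\
  forall K : set G, compact K ->
    forall e : R, 0 < e -> \forall n \near \oo, forall u, G0 u ->
      [/\ finite_set (fib (S n) u),
          finite_set (setmul K (fib (S n) u) `\` fib (S n) u) &
          ((card (setmul K (fib (S n) u) `\` fib (S n) u))%:R
             <= e * (card (fib (S n) u))%:R)].

Definition almost_finite_in_measure : Prop :=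
  forall K : set G, compact K -> forall e : R, 0 < e ->
    exists H : set G, [/\ elementary H,
      (forall u, unitspace H u ->
         [/\ finite_set (fib H u),
             finite_set (setmul K (fib H u) `\` fib H u) &
             (card (setmul K (fib H u) `\` fib H u))%:R < e * (card (fib H u))%:R]) &
      (forall mu, invariant_measures mu -> ((1 - e)%:E < mu (unitspace H : set BorelG))%E)].

End Groupoid.

(* Main.v *)
Require Import Defs.
From mathcomp Require Import all_boot all_order all_algebra finmap lra.
From mathcomp Require Import all_classical all_reals all_analysis. 
From mathcomp Require Import measurable_realfun.
Import Order.TTheory GRing.Theory Num.Theory.
Local Open Scope classical_set_scope.
Local Open Scope ring_scope.

(** Quasi-tiling in the style of Ornstein and Weiss. Since the heights are
    controlled, all columns of a normal set S_n have the same height h, and for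
    a unit u the set S_n u is a tile with h points in the orbit of u. By (a) the
    t-th level map u |-> f(t) u almost preserves every invariant measure, so on
    average each unit lies in h tiles.

    Tiles are placed in stages, the most invariant ones first. In a stage one
    runs through the columns of S_n and adds the tile at u whenever it meets the
    part A covered so far in at most e h points, keeping only the points outside
    A; tiles of one column are disjoint, so no further selection is needed. At
    the end of the stage the tile of each unit meets the new covered part A' in
    at least e h points. As the earlier tiles are very invariant under S_n^-1,
    the tiles of most units outside A do not meet A, hence meet A' \ A in at
    least e h points; averaging, A' \ A has measure at least about e times that
    of the complement of A. After N stages the uncovered part has measure about
    (1 - e)^N, and the trimmed tiles form a castle. *)

(** * Cardinalities and counting with respect to a probability measure *)

Section Counting.
Set Implicit Arguments.
Unset Strict Implicit.
Context (G : ptopologicalType).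
Implicit Types (X Y : set G).

(** A relation stands in place of a function from [X] to the indices, so that points of tiles and
    fibres can be indexed by levels without choosing a level for each. The points picked by [xget],
    one for each index, exhaust [X]. *)
Lemma card_le_size (I : eqType) (js : seq I) (Rel : I -> G -> Prop) X :
  (forall z, X z -> exists2 j, j \in js & Rel j z) ->
  (forall j z z', X z -> X z' -> Rel j z -> Rel j z' -> z = z') ->
  finite_set X /\ (Defs.card X <= size js)%N.
Proof.
move=> Xjs fun_Rel.
pose f j := xget point [set z | X z /\ Rel j z].
have subX : {subset X <= [seq f j | j <- js]}.
  move=> z /set_mem Xz; have [j jjs jz] := Xjs z Xz.
  apply/mapP; exists j => //; rewrite /f; case: xgetP => [z' _ [Xz' jz']|/(_ z)].
    exact: fun_Rel Xz Xz' jz jz'.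
  by case.
have finX : finite_set X.
  apply: (sub_finite_set (B := [set` [seq f j | j <- js]])); last exact: finite_seq.
  by move=> z Xz /=; apply: subX; rewrite inE.
split => //; rewrite /Defs.card -(size_map f js).
apply: uniq_leq_size; first exact: fset_uniq.
by move=> z; rewrite (in_fset_set finX) => /subX.
Qed.

Lemma size_le_card (I : eqType) (js : seq I) (Rel : I -> G -> Prop) X :
  finite_set X -> uniq js ->
  (forall j, j \in js -> exists2 z, X z & Rel j z) ->
  (forall i j z, i \in js -> j \in js -> Rel i z -> Rel j z -> i = j) ->
  (size js <= Defs.card X)%N.
Proof.
move=> finX ujs jsX inj_Rel.
pose f j := xget point [set z | X z /\ Rel j z].
have fP j : j \in js -> X (f j) /\ Rel j (f j).
  move=> /jsX[z Xz jz]; rewrite /f; case: xgetP => [z' _ //|/(_ z)].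
  by case.
rewrite /Defs.card -(size_map f js); apply: uniq_leq_size.
  rewrite map_inj_in_uniq // => i j iJ jJ fij.
  apply: (inj_Rel i j (f j)) => //; last by case: (fP _ jJ).
  by rewrite -fij; case: (fP _ iJ).
by move=> z /mapP[j jJ ->]; rewrite (in_fset_set finX) inE; case: (fP _ jJ).
Qed.

Lemma card_inj_le (f : G -> G) X Y : finite_set Y ->
  (forall x, X x -> Y (f x)) ->
  (forall x y, X x -> X y -> f x = f y -> x = y) ->
  finite_set X /\ (Defs.card X <= Defs.card Y)%N.
Proof.
move=> finY XY f_inj.
apply: (@card_le_size _ (fset_set Y) (fun y x => f x = y)).
  by move=> x Xx; exists (f x) => //; rewrite (in_fset_set finY) inE; apply: XY.
by move=> y x x' Xx Xx' <- fxx'; apply: f_inj.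
Qed.

Lemma card_subset X Y : finite_set Y -> X `<=` Y ->
  finite_set X /\ (Defs.card X <= Defs.card Y)%N.
Proof. by move=> finY XY; apply: (@card_inj_le id). Qed.

Lemma card_setU_le X Y : finite_set X -> finite_set Y ->
  finite_set (X `|` Y) /\ (Defs.card (X `|` Y) <= Defs.card X + Defs.card Y)%N.
Proof.
move=> finX finY; rewrite -size_cat.
apply: (@card_le_size _ _ (fun y x => x = y)); last by move=> j z z' _ _ -> ->.
move=> x XYx; exists x => //; rewrite mem_cat !in_fset_set //.
by apply/orP; rewrite !inE.
Qed.

Lemma sum_indic (R : pzRingType) (T I : Type) (js : seq I) (E : I -> set T) x :
  \sum_(i <- js) (\1_(E i) x : R) = (count (fun i => x \in E i) js)%:R.
Proof.
elim: js => [|i js IH]; first by rewrite big_nil.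
by rewrite big_cons IH indicE /= natrD.
Qed.


End Counting.

Section MeasureCounting.
Set Implicit Arguments.
Unset Strict Implicit.
Context (d : measure_display) (T : measurableType d) (R : realType)
  (mu : probability T R).
Implicit Types (A B W : set T).

Definition mass A : R := fine (mu A).

Lemma massE A : measurable A -> (mass A)%:E = mu A.
Proof. by move=> mA; rewrite fineK // fin_num_measure. Qed.

Lemma mass_ge0 A : 0 <= mass A.
Proof. by rewrite fine_ge0 // measure_ge0. Qed.

Lemma mass0 : mass set0 = 0.
Proof. by rewrite /mass measure0. Qed.

Lemma mass_le A B : measurable A -> measurable B -> A `<=` B ->
  mass A <= mass B.
Proof. by move=> mA mB AB; rewrite -lee_fin !massE // le_measure // inE. Qed.

Lemma massU A B : measurable A -> measurable B -> A `&` B = set0 ->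
  mass (A `|` B) = mass A + mass B.
Proof.
move=> mA mB AB0; apply: EFin_inj; rewrite EFinD !massE //; last exact: measurableU.
by rewrite measureU.
Qed.

Lemma mass_split A B : measurable A -> measurable B ->
  mass A = mass (A `&` B) + mass (A `\` B).
Proof.
move=> mA mB; rewrite -massU ?setUIDK//; first exact: measurableI.
  exact: measurableD.
by apply/seteqP; split => x //= [[_ Bx] [_ /(_ Bx)]].
Qed.

Section integral.
Context (I : Type) (js : seq I) (E : I -> set T) (W : set T) (c : R).
Hypotheses (mW : measurable W) (mE : forall i, measurable (E i)) (c0 : 0 <= c).

Let integral_count :
  (\int[mu]_(x in W) ((\sum_(i <- js) \1_(E i) x)%:E))%E
  = (\sum_(i <- js) mass (E i `&` W))%:E.
Proof.
under eq_integral do rewrite -sumEFin.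
rewrite (@ge0_integral_sum _ _ _ mu W mW I (fun i x => (\1_(E i) x)%:E)); first last.
- by move=> i x _; rewrite lee_fin indicE.
- by move=> i; apply/measurable_EFinP; apply: measurable_indic.
rewrite -sumEFin; apply: eq_bigr => i _.
by rewrite integral_indic // massE //; exact: measurableI.
Qed.

Let measurable_count :
  measurable_fun W (fun x => (\sum_(i <- js) \1_(E i) x)%:E : \bar R).
Proof.
apply/measurable_EFinP; apply: measurable_sum => i.
by apply: measurable_indic.
Qed.

Let count_ge0 x : 0 <= \sum_(i <- js) (\1_(E i) x : R).
Proof. by apply: sumr_ge0 => i _; rewrite indicE. Qed.

(** Double counting: the integral over [W] of the number of sets [E i] that contain a point is the
    sum of the masses of the sets [E i] inside [W]. *)
Lemma mass_count_ge : (forall x, W x -> c <= \sum_(i <- js) \1_(E i) x) ->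
  c * mass W <= \sum_(i <- js) mass (E i).
Proof.
move=> cE; apply: (@le_trans _ _ (\sum_(i <- js) mass (E i `&` W))).
  rewrite -lee_fin -integral_count EFinM massE // -integral_cst //.
  apply: ge0_le_integral => //= x Wx; rewrite lee_fin //; exact: cE.
apply: ler_sum => i _; apply: mass_le => //; exact: measurableI.
Qed.

Lemma mass_count_le : (forall i, E i `<=` W) ->
  (forall x, W x -> \sum_(i <- js) \1_(E i) x <= c) ->
  \sum_(i <- js) mass (E i) <= c * mass W.
Proof.
move=> EW cE; under eq_bigr do rewrite -(setIidl (EW _)).
rewrite -lee_fin -integral_count EFinM massE // -integral_cst //.
apply: ge0_le_integral => //= x Wx; rewrite lee_fin //; exact: cE.
Qed.

End integral.

Lemma mass_bigcup_le (I : eqType) (js : seq I) (E : I -> set T) W :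
  measurable W -> (forall i, measurable (E i)) ->
  (forall x, W x -> exists2 i, i \in js & E i x) ->
  mass W <= \sum_(i <- js) mass (E i).
Proof.
move=> mW mE WE; rewrite -[mass W]mul1r; apply: mass_count_ge => // x Wx.
rewrite sum_indic ler1n -has_count; have [i ijs Ei] := WE _ Wx.
by apply/hasP; exists i => //; apply: mem_set.
Qed.

Lemma mass_bigcup_ge (I : eqType) (js : seq I) (E : I -> set T) W :
  measurable W -> (forall i, measurable (E i)) -> uniq js ->
  (forall i, E i `<=` W) -> (forall i j x, E i x -> E j x -> i = j) ->
  \sum_(i <- js) mass (E i) <= mass W.
Proof.
move=> mW mE ujs EW Edisj; rewrite -[leRHS]mul1r; apply: mass_count_le => // x Wx.
rewrite sum_indic lern1 -size_filter.
have : uniq [seq i <- js | x \in E i] by rewrite filter_uniq.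
have : all (fun i => x \in E i) [seq i <- js | x \in E i] by exact: filter_all.
case: (seq.filter _ _) => [|i [|j js']] /=; [by []| by [] |].
move=> /and3P[/set_mem Ei /set_mem Ej _].
by rewrite (Edisj i j x Ei Ej) inE eqxx.
Qed.

End MeasureCounting.

(** * Ample groupoids *)

Section Groupoid.
Set Implicit Arguments.
Unset Strict Implicit.
Context (G : ptopologicalType) (s r : G -> G) (mul : G -> G -> G) (inv : G -> G).
Hypothesis HG : ample_groupoid s r mul inv.
Implicit Types (A B U V : set G) (a b c u x y z : G).

Lemma src_src a : s (s a) = s a. Proof. by case: HG => -[/(_ a)[]]. Qed.
Lemma rng_src a : r (s a) = s a. Proof. by case: HG => -[/(_ a)[_ []]]. Qed.
Lemma src_mul a b : s a = r b -> s (mul a b) = s b.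
Proof. by case: HG => -[_ H _ _ _] _ /H[]. Qed.
Lemma rng_mul a b : s a = r b -> r (mul a b) = r a.
Proof. by case: HG => -[_ H _ _ _] _ /H[]. Qed.
Lemma gmulA a b c : s a = r b -> s b = r c -> mul (mul a b) c = mul a (mul b c).
Proof. by case: HG => -[_ _ H _ _] _; apply: H. Qed.
Lemma mul_rng a : mul (r a) a = a.
Proof. by case: HG => -[_ _ _ /(_ a)[] ]. Qed.
Lemma mul_src a : mul a (s a) = a.
Proof. by case: HG => -[_ _ _ /(_ a)[] ]. Qed.
Lemma src_inv a : s (inv a) = r a.
Proof. by case: HG => -[_ _ _ _ /(_ a)[] ]. Qed.
Lemma rng_inv a : r (inv a) = s a.
Proof. by case: HG => -[_ _ _ _ /(_ a)[_ [] ]]. Qed.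
Lemma mul_inv a : mul a (inv a) = r a.
Proof. by case: HG => -[_ _ _ _ /(_ a)[_ [_ [] ]]]. Qed.
Lemma inv_mul a : mul (inv a) a = s a.
Proof. by case: HG => -[_ _ _ _ /(_ a)[_ [_ [] ]]]. Qed.

Lemma G0_src u : G0 s u -> s u = u.
Proof. by case=> a _ <-; rewrite src_src. Qed.
Lemma G0_rng u : G0 s u -> r u = u.
Proof. by case=> a _ <-; rewrite rng_src. Qed.
Lemma G0_s a : G0 s (s a). Proof. by exists a. Qed.

Lemma gmulKl a b : s a = r b -> mul (inv a) (mul a b) = b.
Proof.
by move=> ab; rewrite -gmulA ?src_inv // inv_mul ab mul_rng.
Qed.

Lemma gmulKr a b : s a = r b -> mul (mul a b) (inv b) = a.
Proof. by move=> ab; rewrite gmulA ?rng_inv // mul_inv -ab mul_src. Qed.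

Lemma gmulIr a a' b : s a = r b -> s a' = r b -> mul a b = mul a' b -> a = a'.
Proof. by move=> ab a'b /(congr1 (mul ^~ (inv b))); rewrite /= !gmulKr. Qed.

Lemma gmulIl a b b' : s a = r b -> s a = r b' -> mul a b = mul a b' -> b = b'.
Proof. by move=> ab ab' /(congr1 (mul (inv a))); rewrite !gmulKl. Qed.

Lemma src_cont : continuous s. Proof. by case: HG => _ [[]]. Qed.
Lemma rng_cont : continuous r. Proof. by case: HG => _ [[]]. Qed.
Lemma inv_cont : continuous inv. Proof. by case: HG => _ [[]]. Qed.
Lemma G_hausdorff : hausdorff_space G. Proof. by case: HG => _ [_ []]. Qed.

(** Openness of an image can be checked near each point, and every point lies in an open bisection,
    on which [s] and [r] are open maps. *)
Lemma open_src_rng U : open U -> open (s @` U) /\ open (r @` U).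
Proof.
move=> oU; have [_ [_ _ Hb _ _]] := HG.
have openW (f : G -> G) : (forall x, exists2 B, [/\ open B & B x] &
    forall V, open V -> V `<=` B -> open (f @` V)) -> open (f @` U).
  move=> fP; rewrite openE => _ [x Ux <-]; have [B [oB Bx] fB] := fP x.
  apply: (@filterS _ _ _ (f @` (U `&` B))); first by move=> _ [y [Uy _] <-]; exists y.
  apply: open_nbhs_nbhs; split; last by exists x.
  by apply: fB; [exact: openI | exact: subIsetr].
by split; apply: openW => x; have [B [[oB _ HB] Bx]] := Hb x;
  exists B => // V oV /(HB V oV)[].
Qed.

Definition compact_open_set A := compact A /\ open A.

Lemma compact_open_closed A : compact_open_set A -> closed A.
Proof. by case=> cA _; apply: compact_closed => //; apply: G_hausdorff. Qed.

Lemma compact_open0 : compact_open_set set0.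
Proof. by split; [exact: compact0 | exact: open0]. Qed.

Lemma compact_openU A B : compact_open_set A -> compact_open_set B -> compact_open_set (A `|` B).
Proof. by move=> [cA oA] [cB oB]; split; [exact: compactU | exact: openU]. Qed.

Lemma compact_openI A B : compact_open_set A -> open B -> closed B -> compact_open_set (A `&` B).
Proof. by move=> [cA oA] oB cB; split; [exact: compact_closedI | exact: openI]. Qed.

Lemma compact_openD A B : compact_open_set A -> compact_open_set B -> compact_open_set (A `\` B).
Proof.
move=> coA coB; rewrite setDE; apply: compact_openI => //.
  by apply: closed_openC; apply: compact_open_closed.
by apply: open_closedC; case: coB.
Qed.

Lemma compact_openII A B : compact_open_set A -> compact_open_set B -> compact_open_set (A `&` B).
Proof.
move=> coA coB; apply: compact_openI => //; first by case: coB.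
exact: compact_open_closed.
Qed.

Lemma compact_openI_src A B : compact_open_set A -> compact_open_set B ->
  compact_open_set (A `&` s @^-1` B).
Proof.
move=> coA coB; apply: compact_openI => //.
  by apply: open_comp; [move=> *; exact: src_cont | case: coB].
by apply: closed_comp; [move=> *; exact: src_cont | exact: compact_open_closed].
Qed.

Lemma compact_openI_rng A B : compact_open_set A -> compact_open_set B ->
  compact_open_set (A `&` r @^-1` B).
Proof.
move=> coA coB; apply: compact_openI => //.
  by apply: open_comp; [move=> *; exact: rng_cont | case: coB].
by apply: closed_comp; [move=> *; exact: rng_cont | exact: compact_open_closed].
Qed.

Lemma compact_open_src A : compact_open_set A -> compact_open_set (s @` A).
Proof.
move=> [cA oA]; split; last by case: (open_src_rng oA).
by apply: continuous_compact => //; apply: continuous_subspaceT => x; exact: src_cont.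
Qed.

Lemma compact_open_rng A : compact_open_set A -> compact_open_set (r @` A).
Proof.
move=> [cA oA]; split; last by case: (open_src_rng oA).
by apply: continuous_compact => //; apply: continuous_subspaceT => x; exact: rng_cont.
Qed.

Lemma compact_inv A : compact A -> compact (inv @` A).
Proof.
by move=> cA; apply: continuous_compact => //; apply: continuous_subspaceT => x; exact: inv_cont.
Qed.

Lemma compact_open_bigcup (I : choiceType) (D : set I) (F : I -> set G) :
  finite_set D -> (forall i, D i -> compact_open_set (F i)) ->
  compact_open_set (\bigcup_(i in D) F i).
Proof.
move=> finD coF; rewrite -bigsetU_fset_set //.
rewrite big_seq; elim/big_ind : _ => //; first exact: compact_open0.
  exact: compact_openU.
by move=> i; rewrite (in_fset_set finD) inE; apply: coF.
Qed.

Lemma bisection_sub A B : A `<=` B -> bisection s r B -> bisection s r A.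
Proof.
move=> AB [injs injr]; split=> x y /AB Bx /AB By_; [exact: injs | exact: injr].
Qed.

Lemma compact_open_bisectionP A : compact_open_set A -> bisection s r A ->
  compact_open_bisection s r A.
Proof.
move=> [cA oA] bA; split => //; split => // U oU _; exact: open_src_rng.
Qed.

End Groupoid.

(** * Multisections *)

Section Multisection.
Set Implicit Arguments.
Unset Strict Implicit.
Context (G : ptopologicalType) (s r : G -> G) (mul : G -> G -> G) (inv : G -> G).
Hypothesis HG : ample_groupoid s r mul inv.

Section Algebra.
Context (k : nat) (C : nat -> nat -> set G).
Hypothesis mC : multisection s r mul k C.
Implicit Types (i j l : 'I_k) (a b c u x y : G).

Lemma ms_unit i u : C i i u -> s u = u /\ r u = u.
Proof.
case: mC => _ _ C0 _ Cu; have G0u : G0 s u by apply: C0 Cu.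
by rewrite (G0_src HG G0u) (G0_rng HG G0u).
Qed.

Lemma ms_mul i j l x y : C i j x -> C j l y -> s x = r y -> C i l (mul x y).
Proof.
move=> Cx Cy xy; have [_ Cmul _ _] := mC.
by rewrite -(Cmul i j l) //; exists x, y.
Qed.

Lemma ms_rng i j x : C i j x -> C i i (r x).
Proof.
move=> Cx; have [_ Cmul _ _] := mC.
move: (Cx); rewrite -(Cmul i i j) // => -[a [b [Ca Cb ab ->]]].
by rewrite (rng_mul HG) //; have [_ ->] := ms_unit Ca.
Qed.

Lemma ms_src i j x : C i j x -> C j j (s x).
Proof.
move=> Cx; have [_ Cmul _ _] := mC.
move: (Cx); rewrite -(Cmul i j j) // => -[a [b [Ca Cb ab ->]]].
by rewrite (src_mul HG) //; have [-> _] := ms_unit Cb.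
Qed.

Lemma ms_ex_src i j u : C j j u -> exists2 x, C i j x & s x = u.
Proof.
move=> Cu; have [_ Cmul _ _] := mC.
move: (Cu); rewrite -(Cmul j i j) // => -[a [b [Ca Cb ab uab]]].
by exists b => //; rewrite -(src_mul HG ab) -uab; case: (ms_unit Cu).
Qed.

Lemma ms_inj_src i j x y : C i j x -> C i j y -> s x = s y -> x = y.
Proof. by case: mC => /(_ i j (ltn_ord i) (ltn_ord j))[inj _] _ _ _; exact: inj. Qed.

Lemma ms_inj_rng i j x y : C i j x -> C i j y -> r x = r y -> x = y.
Proof. by case: mC => /(_ i j (ltn_ord i) (ltn_ord j))[_ inj] _ _ _; exact: inj. Qed.

(** Closure under inverses follows from the product rule: [s x] lies in [C j j], so it is a product
    of some [a] in [C j i] and [b] in [C i j]. Injectivity of [s] on [C i j] forces [b = x], and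
    then [a] is [inv x]. *)
Lemma ms_inv i j x : C i j x -> C j i (inv x).
Proof.
move=> Cx; have Cu := ms_src Cx; have [_ Cmul _ _] := mC.
move: (Cu); rewrite -(Cmul j i j) // => -[a [b [Ca Cb ab uab]]].
have bx : b = x.
  by apply: (ms_inj_src Cb Cx); rewrite -(src_mul HG ab) -uab (src_src HG).
by rewrite -bx -(gmulKr HG ab) -uab -bx -(rng_inv HG b) (mul_rng HG) in Ca *.
Qed.

Lemma ms_ex_rng i j u : C i i u -> exists2 x, C i j x & r x = u.
Proof.
move=> /(ms_ex_src j)[x Cx xu]; exists (inv x); first exact: ms_inv.
by rewrite (rng_inv HG).
Qed.

Lemma ms_rngE i j : r @` C i j = C i i.
Proof.
apply/seteqP; split=> [_ [x Cx <-]|u]; first exact: ms_rng Cx.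
by move=> /(ms_ex_rng j)[x Cx xu]; exists x.
Qed.

Lemma ms_disj i j u : C i i u -> C j j u -> i = j.
Proof.
move=> Ci Cj; apply/val_inj/eqP/negPn/negP => /eqP nij.
case: mC => _ _ _ /(_ i j (ltn_ord i) (ltn_ord j) nij).
by apply/eqP/set0P; exists u.
Qed.

(** The preimage of [A] under the level map from [C j j] to [C i i], which sends the source of an
    arrow of [C i j] to its range. *)
Definition preimage_level i j (A : set G) : set G := s @` (C i j `&` r @^-1` A).

Lemma preimage_levelP i j (A : set G) c : C i j c ->
  preimage_level i j A (s c) <-> A (r c).
Proof.
move=> Cc; split=> [[c' [Cc' Ac'] /(ms_inj_src Cc' Cc) <-] //|Ac].
by exists c.
Qed.

Lemma preimage_level_sub i j (A : set G) : preimage_level i j A `<=` C j j.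
Proof. by move=> _ [c [Cc _] <-]; exact: ms_src Cc. Qed.

(** The multisection cut down to the columns through [W] in level [j]: the arrows of [C l j] carry
    [W] to level [l], where sources are then required to lie. *)
Definition restrict_ms (j : 'I_k) (W : set G) (i l : nat) : set G :=
  C i l `&` s @^-1` (r @` (C l j `&` s @^-1` W)).

Section Restrict.
Context (j : 'I_k) (W : set G).

Lemma restrict_bisection i : forall x, restrict_ms j W i j x <-> C i j x /\ W (s x).
Proof.
move=> x; split=> [[Cx [c [Cc Wc] cx]]|[Cx Wx]].
  by split => //; rewrite -cx; have [ss rr] := ms_unit Cc; rewrite rr -ss.
split=> //; exists (s x); last exact: rng_src HG _.
by split; [exact: ms_src Cx | rewrite /= (src_src HG)].
Qed.

Lemma restrict_level i y :
  restrict_ms j W i i y <-> exists2 c, C i j c /\ W (s c) & r c = y.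
Proof.
split=> [[Cy [c Cc cy]]|[c [Cc Wc] cy]].
  by exists c => //; rewrite cy; case: (ms_unit Cy).
have Cy : C i i y by rewrite -cy; exact: ms_rng Cc.
by split=> //; exists c => //; have [-> _] := ms_unit Cy.
Qed.

Lemma restrict_multisection : multisection s r mul k (restrict_ms j W).
Proof.
have [Cbis Cmul C0 Cdisj] := mC; split.
- move=> i l ik lk; apply: (bisection_sub (B := C i l)); last exact: Cbis.
  exact: subIsetl.
- move=> i l n ik lk nk; apply/seteqP; split => [_ [x [y [[Cx _] [Cy Wy] xy ->]]]|].
    split; first by rewrite -(Cmul i l n) //; exists x, y.
    by rewrite /= (src_mul HG).
  move=> z [Cz [c [Cc Wc] cz]].
  move: (Cz); rewrite -(Cmul i l n) // => -[x [y [Cx Cy xy zxy]]].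
  have yc : s y = r c by rewrite cz zxy (src_mul HG).
  exists x, y; split=> //; last by split=> //; exists c => //; rewrite cz zxy (src_mul HG).
  split=> //; exists (mul y c); last by rewrite (rng_mul HG).
  split; last by rewrite /= (src_mul HG).
  by apply: (@ms_mul (Ordinal lk) (Ordinal nk) j).
- by move=> i ik x [/(C0 i ik)].
- move=> i l ik lk il; apply/seteqP; split => // x [[Ci _] [Cl _]].
  by rewrite -[set0](Cdisj i l).
Qed.

End Restrict.

Lemma reindex_multisection (k' : nat) (e : nat -> nat) :
  (forall i : nat, (i < k')%N -> (e i < k)%N) ->
  (forall i j : nat, (i < k')%N -> (j < k')%N -> e i = e j -> i = j) ->
  multisection s r mul k' (fun i j : nat => C (e i) (e j)).
Proof.
move=> ek e_inj; have [Cbis Cmul C0 Cdisj] := mC; split.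
- by move=> i j /ek ? /ek ?; apply: Cbis.
- by move=> i j l /ek ? /ek ? /ek ?; apply: Cmul.
- by move=> i /ek ?; apply: C0.
- move=> i j ik jk ij; apply: Cdisj; [exact: ek | exact: ek |].
  by move/(e_inj _ _ ik jk).
Qed.

End Algebra.

Section Topology.
Context (k : nat) (C : nat -> nat -> set G).
Hypothesis mC : compact_open_multisection s r mul k C.

Lemma compact_open_ms (i j : 'I_k) : compact_open_set (C i j).
Proof. by case: mC => _ /(_ i j (ltn_ord i) (ltn_ord j))[]. Qed.

Lemma compact_open_preimage_level (i j : 'I_k) (A : set G) :
  compact_open_set A -> compact_open_set (preimage_level C i j A).
Proof.
move=> coA; apply: (compact_open_src HG); apply: (compact_openI_rng HG) => //.
exact: compact_open_ms.
Qed.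

Lemma compact_open_restrict (j : 'I_k) (W : set G) : compact_open_set W ->
  compact_open_multisection s r mul k (restrict_ms C j W).
Proof.
move=> coW; have [C_ms _] := mC; split; first exact: restrict_multisection.
move=> i l ik lk; apply: (compact_openI_src HG).
  exact: (@compact_open_ms (Ordinal ik) (Ordinal lk)).
apply: (compact_open_rng HG); apply: (compact_openI_src HG) => //.
exact: (compact_open_ms (Ordinal lk) j).
Qed.

Lemma compact_open_reindex (k' : nat) (e : nat -> nat) :
  (forall i : nat, (i < k')%N -> (e i < k)%N) ->
  (forall i j : nat, (i < k')%N -> (j < k')%N -> e i = e j -> i = j) ->
  compact_open_multisection s r mul k' (fun i j : nat => C (e i) (e j)).
Proof.
move=> ek e_inj; have [C_ms _] := mC; split; first exact: (reindex_multisection C_ms).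
move=> i j /ek ik /ek jk.
exact: (compact_open_ms (Ordinal ik) (Ordinal jk)).
Qed.

End Topology.

(** * Invariant measures on the levels of a multisection *)

Section Invariance.
Context (R : realType) (mu : probability (BorelG G) R).
Hypothesis muP : invariant_measures s r mu.

Lemma measurable_compact_open (A : set G) : compact_open_set A ->
  measurable (A : set (BorelG G)).
Proof. by move=> [_ oA]; apply: sub_sigma_algebra. Qed.

(** The part of [B] with range in [A] is again a compact open bisection, so invariance applies to
    it. *)
Lemma mass_bisection (B A : set G) : compact_open_set B -> bisection s r B ->
  compact_open_set A ->
  mass mu (s @` (B `&` r @^-1` A)) = mass mu (r @` B `&` A).
Proof.
move=> coB bB coA; case: muP => _ inv_mu.
rewrite /mass inv_mu; last first.
  apply: (compact_open_bisectionP HG); first exact: (compact_openI_rng HG).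
  exact: bisection_sub (@subIsetl _ _ _) bB.
congr (fine (mu _)); apply/seteqP; split=> [_ [x [Bx Ax] <-]|_ [[x Bx <-] Ax]].
  by split=> //; exists x.
by exists x.
Qed.

Lemma mass_preimage_level k C (i j : 'I_k) (A : set G) :
  compact_open_multisection s r mul k C -> compact_open_set A ->
  mass mu (preimage_level C i j A) = mass mu (C i i `&` A).
Proof.
move=> coC coA; have [mC _] := coC; rewrite mass_bisection ?(ms_rngE mC)//.
  exact: (compact_open_ms coC).
by case: mC => + _ _ _; apply.
Qed.

Lemma mass_level k C (i j : 'I_k) : compact_open_multisection s r mul k C ->
  mass mu (C i i) = mass mu (C j j).
Proof.
move=> coC; have [mC _] := coC.
rewrite -[C i i]setIid -(mass_preimage_level i j coC); last exact: (compact_open_ms coC).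
congr (mass mu _); apply/seteqP; split; first exact: (preimage_level_sub mC).
move=> u /(ms_ex_src mC i)[c Cc cu]; exists c => //; split=> //.
exact: (ms_rng mC Cc).
Qed.

End Invariance.
End Multisection.

(** * Tilings by towers *)

Section Tilings.
Set Implicit Arguments.
Unset Strict Implicit.
Context (G : ptopologicalType) (s r : G -> G) (mul : G -> G -> G) (inv : G -> G).
Hypothesis HG : ample_groupoid s r mul inv.
Context (R : realType).

(** A column of tiles with its root level and the levels that survive trimming. The full
    multisection is retained, because the invariance of a tile refers to all of its points. *)
Record tower := Tower {
  tw_h : nat;
  tw_C : nat -> nat -> set G;
  tw_root : 'I_tw_h;
  tw_kept : {set 'I_tw_h} }.

Definition kept_levels (p : tower) : set G :=
  \bigcup_(i in [set i | i \in tw_kept p]) tw_C p i i.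

Definition tile (p : tower) (v : G) : set G :=
  [set x | exists2 i : 'I_(tw_h p), tw_C p i (tw_root p) x & s x = v].

Fixpoint covered (P : seq tower) : set G :=
  if P is p :: P' then kept_levels p `|` covered P' else set0.

(** Here [tw_h p] plays the part of the number of points of the tile: over a unit of the root level
    of a multisection, each level contributes exactly one. *)
Definition folner_tile (K : set G) (d : R) (p : tower) (v : G) : Prop :=
  finite_set (setmul s r mul K (tile p v) `\` tile p v) /\
  (Defs.card (setmul s r mul K (tile p v) `\` tile p v))%:R <= d * (tw_h p)%:R.

Definition good_tower (e : R) (K : set G) (d : R) (p : tower) : Prop :=
  [/\ compact_open_multisection s r mul (tw_h p) (tw_C p),
      (1 - e) * (tw_h p)%:R <= #|tw_kept p|%:R &
      forall v, tw_C p (tw_root p) (tw_root p) v -> folner_tile K d p v].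

(* The head of the list is the tower placed last; its discarded levels lie in
   the part covered by the towers placed before it. *)
Fixpoint tiling (e : R) (K : set G) (d : R) (P : seq tower) : Prop :=
  if P is p :: P' then
    [/\ good_tower e K d p, kept_levels p `&` covered P' = set0,
        forall i : 'I_(tw_h p), tw_C p i i `<=` kept_levels p `|` covered P' &
        tiling e K d P']
  else True.

Lemma good_tower_mono e (K K' : set G) d d' p : K `<=` K' -> d' <= d ->
  good_tower e K' d' p -> good_tower e K d p.
Proof.
move=> KK' dd' [coC kept fol]; split=> // v /fol[finK' cardK'].
have [finK cardK] : finite_set (setmul s r mul K (tile p v) `\` tile p v) /\
   (Defs.card (setmul s r mul K (tile p v) `\` tile p v) <=
    Defs.card (setmul s r mul K' (tile p v) `\` tile p v))%N.
  apply: card_subset => // x [[a [b [Ka tb ab ->]]] ntx]; split=> //.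
  by exists a, b; split=> //; exact: KK'.
split=> //; apply: (@le_trans _ _ (d' * (tw_h p)%:R)); last exact: ler_wpM2r.
by apply: le_trans cardK'; rewrite ler_nat.
Qed.

Lemma tiling_mono e (K K' : set G) d d' P : K `<=` K' -> d' <= d ->
  tiling e K' d' P -> tiling e K d P.
Proof.
move=> KK' dd'; elim: P => //= p P IH [gp disj lev /IH til]; split=> //.
exact: good_tower_mono gp.
Qed.

Lemma compact_open_kept e K d p : good_tower e K d p ->
  compact_open_set (kept_levels p).
Proof.
case=> coC _ _; apply: compact_open_bigcup; first exact: finite_finset.
by move=> i _; apply: (compact_open_ms coC).
Qed.

Lemma compact_open_covered e K d P : tiling e K d P -> compact_open_set (covered P).
Proof.
elim: P => [_|p P IH /= [gp _ _ /IH coP]]; first exact: compact_open0.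
by apply: compact_openU => //; apply: compact_open_kept gp.
Qed.

Lemma kept_levels_G0 e K d p : good_tower e K d p -> kept_levels p `<=` G0 s.
Proof. by case=> -[[_ _ C0 _] _] _ _ x [i _ Cx]; exact: (C0 i). Qed.

Lemma covered_G0 e K d P : tiling e K d P -> covered P `<=` G0 s.
Proof.
elim: P => [|p P IH] /=; first by move=> _ x [].
move=> [gp _ _ /IH PG0] x [|/PG0//].
exact: (kept_levels_G0 gp).
Qed.

(** * Mass of the arrows that enter the covered part from outside *)

Section Escape.
Context (mu : probability (BorelG G) R).
Hypothesis muP : invariant_measures s r mu.

(** The kept levels are pairwise disjoint, and invariance gives each the mass of the root level. *)
Lemma mass_kept_ge e K d p : good_tower e K d p ->
  #|tw_kept p|%:R * mass mu (tw_C p (tw_root p) (tw_root p)) <=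
  mass mu (kept_levels p).
Proof.
move=> gp; have [coC _ _] := gp; have [mC _] := coC.
have mea (i : 'I_(tw_h p)) : measurable (tw_C p i i : set (BorelG G)).
  by apply: measurable_compact_open; apply: (compact_open_ms coC).
have -> : #|tw_kept p|%:R * mass mu (tw_C p (tw_root p) (tw_root p)) =
    \sum_(i <- enum (tw_kept p)) mass mu (tw_C p i i `&` kept_levels p).
  rewrite big_enum /= (eq_bigr (fun=> mass mu (tw_C p (tw_root p) (tw_root p)))).
    by rewrite sumr_const mulr_natl.
  move=> i ik; rewrite -(mass_level HG muP i (tw_root p) coC); congr (mass mu _).
  by apply/seteqP; split=> [x []//|x Cx]; split=> //; exists i.
apply: mass_bigcup_ge => //.
- by apply: measurable_compact_open; apply: compact_open_kept gp.
- move=> i; apply: measurableI => //.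
  by apply: measurable_compact_open; apply: compact_open_kept gp.
- exact: enum_uniq.
- by move=> i j x [Ci _] [Cj _]; apply: (ms_disj mC Ci Cj).
Qed.

(** Pulled back to the base, the traces of [V] on the levels have total mass at most [d h] times
    that of the base. Since [e <= 1/2], at least half of the levels are kept, so [h] times the mass
    of the base is at most twice the mass of the kept part; hence the factor 2. *)
Lemma mass_kept_escape e K (d : R) p (V : set G) : 0 <= d -> e <= 2^-1 ->
  good_tower e K d p -> compact_open_set V ->
  (forall v, tw_C p (tw_root p) (tw_root p) v ->
    (count (fun i => v \in preimage_level s r (tw_C p) i (tw_root p) V)
       (enum 'I_(tw_h p)))%:R <= d * (tw_h p)%:R) ->
  mass mu (V `&` kept_levels p) <= 2 * d * mass mu (kept_levels p).
Proof.
move=> d0 e2 gp coV countV; have [coC keptp _] := gp; have [mC _] := coC.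
have mea (A : set G) : compact_open_set A -> measurable (A : set (BorelG G)).
  exact: measurable_compact_open.
set root := tw_root p in countV *; set base := tw_C p root root.
have coL i : compact_open_set (preimage_level s r (tw_C p) i root V).
  exact: (compact_open_preimage_level HG coC).
apply: (@le_trans _ _ (\sum_(i <- enum 'I_(tw_h p))
    mass mu (preimage_level s r (tw_C p) i root V))).
  under eq_bigr do rewrite (mass_preimage_level HG muP _ _ coC coV).
  apply: mass_bigcup_le.
  - by apply: mea; apply: (compact_openII HG) => //; apply: compact_open_kept gp.
  - move=> i; apply: mea; apply: (compact_openII HG) => //.
    exact: (compact_open_ms coC).
  - by move=> x [Vx [i _ Cx]]; exists i => //; rewrite mem_enum.
apply: (@le_trans _ _ (d * (tw_h p)%:R * mass mu base)).
  apply: mass_count_le.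
  - by apply: mea; apply: (compact_open_ms coC).
  - by move=> i; apply: mea.
  - by move=> i; apply: (preimage_level_sub HG mC).
  - by move=> v /countV; rewrite sum_indic.
have := mass_kept_ge gp; rewrite -/root -/base; set mK := mass mu (kept_levels p).
have := mass_ge0 mu base; set mB := mass mu base => mB0 keptB.
have hB : 2^-1 * (tw_h p)%:R * mB <= mK.
  apply: le_trans keptB; apply: ler_wpM2r => //; apply: le_trans keptp.
  by apply: ler_wpM2r => //; lra.
by rewrite -mulrA mulrAC; nra.
Qed.

(* If g is in B and c in the tile of v, with r c = r g and s g uncovered, then
   g^-1 c escapes from the tile; since B is a bisection, c is recovered from
   g^-1 c. *)
Lemma count_escape e (K B A : set G) d p v : good_tower e K d p ->
  bisection s r B -> inv @` B `<=` K ->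
  (forall i : 'I_(tw_h p), tw_C p i i `<=` A) ->
  tw_C p (tw_root p) (tw_root p) v ->
  (count (fun i => v \in preimage_level s r (tw_C p) i (tw_root p)
                          (r @` (B `&` s @^-1` (G0 s `\` A))))
       (enum 'I_(tw_h p)))%:R <= d * (tw_h p)%:R.
Proof.
move=> gp bB BK levA Cv; have [[mC _] _ fol] := gp.
have [finK cardK] := fol _ Cv; apply: le_trans cardK; rewrite ler_nat -size_filter.
pose Rel (i : 'I_(tw_h p)) z := exists g c, [/\ B g, tw_C p i (tw_root p) c,
  r g = r c & z = mul (inv g) c].
apply: (size_le_card (Rel := Rel)) => //.
- by rewrite filter_uniq // enum_uniq.
- move=> i; rewrite mem_filter => /andP[/set_mem[c [Cc [g [Bg [G0g Ag] gc]] cv]] _].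
  have igc : s (inv g) = r c by rewrite (src_inv HG).
  exists (mul (inv g) c); last by exists g, c.
  split; first by exists (inv g), c; split => //; [apply: BK; exists g | exists i].
  move=> [j Cz _]; apply: Ag; apply: (levA j).
  by have := ms_rng HG mC Cz; rewrite (rng_mul HG) // (rng_inv HG).
- move=> i j z _ _ [g [c [Bg Cc gc ->]]] [g' [c' [Bg' Cc' gc' zE]]].
  have igc : s (inv g) = r c by rewrite (src_inv HG).
  have igc' : s (inv g') = r c' by rewrite (src_inv HG).
  have gg' : g = g'.
    apply: (bB.1) => //; rewrite -(rng_inv HG g) -(rng_inv HG g').
    by rewrite -(rng_mul HG igc) zE (rng_mul HG igc').
  move: zE igc'; rewrite -gg' => zE igc'.
  have cc' := gmulIl HG igc igc' zE.
  by apply: (ms_disj mC (ms_rng HG mC Cc)); rewrite cc'; apply: (ms_rng HG mC Cc').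
Qed.

(** By invariance the sources in question have the mass of their ranges, which form the part of [V]
    inside [A]. This part is estimated tower by tower, and the kept parts of the towers are disjoint
    with union [A]. *)
Lemma mass_escape e (K B : set G) (d : R) P : 0 <= d -> e <= 2^-1 ->
  compact_open_set (G0 s) -> tiling e K d P ->
  compact_open_set B -> bisection s r B -> inv @` B `<=` K ->
  mass mu (s @` (B `&` s @^-1` (G0 s `\` covered P) `&` r @^-1` (covered P)))
    <= 2 * d.
Proof.
move=> d0 e2 coG0 tilP coB bB BK; set A := covered P.
have coA : compact_open_set A := compact_open_covered tilP.
set B' := B `&` s @^-1` (G0 s `\` A).
have coB' : compact_open_set B'.
  by apply: (compact_openI_src HG) => //; exact: (compact_openD HG).
have bB' : bisection s r B' := bisection_sub (@subIsetl _ _ _) bB.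
rewrite (mass_bisection HG muP) //; set V := r @` B'.
have coV : compact_open_set V by exact: (compact_open_rng HG).
have mea (D : set G) : compact_open_set D -> measurable (D : set (BorelG G)).
  exact: measurable_compact_open.
have mA1 : mass mu A <= 1.
  by rewrite -lee_fin massE; [apply: probability_le1; exact: mea | exact: mea].
suff VA : mass mu (V `&` A) <= 2 * d * mass mu A.
  by apply: le_trans VA _; rewrite ler_piMr // mulr_ge0.
(* [V] stays fixed, defined from the whole of [A], while the induction runs over smaller tilings.
   The discarded levels of the head of [Q] are covered by [Q], so all of its levels lie in [A], as
   [count_escape] demands. *)
have key Q : tiling e K d Q -> covered Q `<=` A ->
    mass mu (V `&` covered Q) <= 2 * d * mass mu (covered Q).
  elim: Q => [|p Q IH]; first by rewrite /= setI0 mass0 mulr0.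
  move=> tilQ QA; have [gp disj lev tilQ'] := tilQ.
  have coQ := compact_open_covered tilQ'; have cop := compact_open_kept gp.
  rewrite /= setIUr massU; last 3 first.
  - by apply: mea; exact: (compact_openII HG).
  - by apply: mea; exact: (compact_openII HG).
  - by rewrite setIACA setIid disj setI0.
  rewrite massU //; [|exact: mea|exact: mea].
  rewrite mulrDr; apply: lerD; last by apply: IH => // x Qx; apply: QA; right.
  apply: (mass_kept_escape d0 e2 gp coV) => v Cv.
  apply: (count_escape gp bB BK) => // i x Cx.
  by apply: QA; apply: lev Cx.
exact: key.
Qed.

End Escape.
End Tilings.

(** * Placing the columns of a normal set *)

Section Placement.
Set Implicit Arguments.
Unset Strict Implicit.
Context (G : ptopologicalType) (s r : G -> G) (mul : G -> G -> G) (inv : G -> G).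
Hypothesis HG : ample_groupoid s r mul inv.
Context (R : realType) (e : R) (K : set G) (d : R).
Hypothesis e1 : e <= 1.
Implicit Types (P Q : seq (tower G)).

Lemma count_enum (T : finType) (f : pred T) : count f (enum T) = #|f|.
Proof. by rewrite -sum1_count big_enum_cond sum1_card. Qed.

Section Column.
Context (h : nat) (C : nat -> nat -> set G) (root : 'I_h) (P : seq (tower G)).
Hypothesis coC : compact_open_multisection s r mul h C.
Hypothesis folC : forall v, C root root v ->
  folner_tile s r mul K d (Tower C root [set: 'I_h]%SET) v.
Hypothesis tilP : tiling s r mul e K d P.

Let mC : multisection s r mul h C. Proof. by case: coC. Qed.
Let coP : compact_open_set (covered P). Proof. exact: compact_open_covered tilP. Qed.

(** The base is cut according to the set of levels not yet covered, the pattern. Over the piece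
    [W J] every tile is trimmed in the same way, to the levels in [J], so that the trimmed tiles
    form the single tower [tw J]. *)
Let X (i : 'I_h) : set G := preimage_level s r C i root (covered P).
Let pattern (u : G) : {set 'I_h} := [set i | u \notin X i]%SET.
Let W (J : {set 'I_h}) : set G := C root root `&` [set u | pattern u = J].
Let tw J := Tower (restrict_ms s r C root (W J)) root J.

Implicit Types J : {set 'I_h}.

Let compact_open_W J : compact_open_set (W J).
Proof.
have coX i : compact_open_set (X i) by exact: (compact_open_preimage_level HG coC).
have coB : compact_open_set (C root root) by exact: (compact_open_ms coC).
(* The units of the base whose pattern disagrees with [J] at level [i]. *)
pose bad (i : 'I_h) := if i \in J then X i else C root root `\` X i.
have -> : W J = C root root `\` \bigcup_(i in [set: 'I_h]) bad i.
  apply/seteqP; split=> [u [Cu uJ]|u [Cu nbad]]; split=> //.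
    move=> [i _]; rewrite /bad -uJ inE.
    by case: ifPn => [/negP|/negPn/set_mem Xu [_ //]]; rewrite inE.
  apply/setP => i; rewrite inE; apply/idP/idP => [/negP uX|iJ].
    apply/negPn/negP => iJ; apply: nbad; exists i => //; rewrite /bad (negbTE iJ).
    by split=> // Xu; apply: uX; exact: mem_set.
  by apply/negP => /set_mem Xu; apply: nbad; exists i => //; rewrite /bad iJ.
apply: (compact_openD HG) => //; apply: compact_open_bigcup => [|i _]; first exact: finite_finset.
by rewrite /bad; case: ifP => _ //; exact: (compact_openD HG).
Qed.

Let good_tw J : (1 - e) * h%:R <= #|J|%:R -> good_tower s r mul e K d (tw J).
Proof.
move=> hJ; split => //=; first exact: (compact_open_restrict HG coC).
move=> v /(restrict_bisection HG mC)[Cv [_ Wv]].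
have [sv _] := ms_unit HG mC Cv; rewrite sv in Wv.
have := folC Cv; rewrite /folner_tile /=.
have -> // : tile s (Tower C root [set: 'I_h]%SET) v = tile s (tw J) v.
apply/seteqP; split=> x [i /= Cx sx]; exists i => //=.
  by apply/(restrict_bisection HG mC); split=> //; rewrite sx.
by move/(restrict_bisection HG mC) : Cx => [].
Qed.

Let kept_tw J y : kept_levels (tw J) y <->
  exists i c, [/\ i \in J, C i root c, W J (s c) & r c = y].
Proof.
split=> [[i iJ /(restrict_level HG mC)[c [Cc Wc] cy]]|[i [c [iJ Cc Wc cy]]]].
  by exists i, c.
by exists i => //; apply/(restrict_level HG mC); exists c.
Qed.

Let covered_tw (Js : seq {set 'I_h}) y : covered ([seq tw J | J <- Js] ++ P) y <->
  (exists2 J, J \in Js & kept_levels (tw J) y) \/ covered P y.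
Proof.
elim: Js => [|J Js IH] /=; first by split=> [|[[]|]//]; right.
split=> [[kJ|/IH[[J' J'Js kJ']|]]|[[J']|Py]].
- by left; exists J => //; rewrite inE eqxx.
- by left; exists J' => //; rewrite inE J'Js orbT.
- by right.
- by rewrite inE => /orP[/eqP -> |J'Js kJ']; [left | right; apply/IH; left; exists J'].
- by right; apply/IH; right.
Qed.

Let pattern_covered (i : 'I_h) c : C i root c -> covered P (r c) <-> i \notin pattern (s c).
Proof.
move=> Cc; rewrite inE negbK; split=> [Pc|/set_mem Xc].
  by apply: mem_set; exact/(preimage_levelP mC _ Cc).
exact/(preimage_levelP mC _ Cc).
Qed.

(** A point in a level of the column comes from one unit of the base, which has one pattern; so
    towers of different patterns are disjoint. By the choice of the pattern, kept levels avoid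
    [covered P] and discarded levels lie inside it. *)
Let tiling_tw (Js : seq {set 'I_h}) : uniq Js ->
  (forall J : {set 'I_h}, J \in Js -> (1 - e) * h%:R <= #|J|%:R) ->
  tiling s r mul e K d ([seq tw J | J <- Js] ++ P).
Proof.
elim: Js => [//|J Js IH] /= /andP[nJ uJs] hJs; split.
- by apply: good_tw; apply: hJs; rewrite inE eqxx.
- apply/seteqP; split=> // y [/kept_tw[i [c [iJ Cc [_ WJ] cy]]]].
  move=> /covered_tw[[J' J'Js /kept_tw[i' [c' [_ Cc' [_ WJ'] cy']]]]|].
    have ii' : i = i'.
      apply: (ms_disj mC (u := y)); first by rewrite -cy; exact: (ms_rng HG mC Cc).
      by rewrite -cy'; exact: (ms_rng HG mC Cc').
    rewrite -ii' in Cc'.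
    have cc' : c = c' by apply: (ms_inj_rng mC Cc Cc'); rewrite cy cy'.
    by move: J'Js; rewrite -WJ' -cc' WJ (negbTE nJ).
  by rewrite -cy => /(pattern_covered Cc); rewrite WJ iJ.
- move=> i y /(restrict_level HG mC)[c [Cc [_ WJ]] cy].
  have [iJ|niJ] := boolP (i \in J).
    by left; apply/kept_tw; exists i, c; split=> //; split=> //; exact: (ms_src HG mC Cc).
  right; apply/covered_tw; right; rewrite -cy; apply/(pattern_covered Cc).
  by rewrite WJ.
- by apply: IH => // J' J'Js; apply: hJs; rewrite inE J'Js orbT.
Qed.

(** Towers are added for the patterns with at least [(1 - e) h] uncovered levels. A unit with such a
    pattern has its whole tile covered afterwards, which suffices as [e <= 1]; for any other unit
    more than [e h] points were covered before. *)
Lemma place_column : exists Q, [/\ tiling s r mul e K d Q, covered P `<=` covered Q &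
  forall u, C root root u -> e * h%:R <=
    (count (fun i => u \in preimage_level s r C i root (covered Q)) (enum 'I_h))%:R].
Proof.
pose Js := enum [set J : {set 'I_h} | (1 - e) * h%:R <= (#|J|%:R : R)]%SET.
have JsP J : (J \in Js) = ((1 - e) * h%:R <= (#|J|%:R : R)) by rewrite mem_enum inE.
exists ([seq tw J | J <- Js] ++ P); split.
- by apply: tiling_tw => [|J]; rewrite ?enum_uniq ?JsP.
- by move=> y Py; apply/covered_tw; right.
move=> u Cu; rewrite count_enum.
have [hJ|hJ] := leP ((1 - e) * h%:R) (#|pattern u|%:R : R).
  apply: (@le_trans _ _ h%:R); first by rewrite ler_piMl.
  rewrite ler_nat -[X in (X <= _)%N]card_ord; apply: subset_leq_card.
  apply/fintype.subsetP => i _; rewrite unfold_in.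
  have [c Cc cu] := ms_ex_src HG mC i Cu.
  apply: mem_set; exists c => //; split=> //; apply/covered_tw.
  have [iJ|niJ] := boolP (i \in pattern u).
    left; exists (pattern u); first by rewrite JsP.
    by apply/kept_tw; exists i, c; rewrite cu; split.
  by right; apply/(pattern_covered Cc); rewrite cu.
apply: (@le_trans _ _ (#|~: pattern u|%SET%:R)).
  have /(congr1 (fun n => n%:R : R)) := cardsC (pattern u).
  by rewrite natrD card_ord; lra.
rewrite ler_nat; apply: subset_leq_card.
apply/fintype.subsetP => i; rewrite finset.in_setC => niJ; rewrite unfold_in.
have [c Cc cu] := ms_ex_src HG mC i Cu.
apply: mem_set; exists c => //; split=> //; apply/covered_tw; right.
by apply/(pattern_covered Cc); rewrite cu.
Qed.

End Column.

(** The columns are placed one after another; the covered part only grows, so the counts reached for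
    earlier columns persist. *)
Lemma place_columns (m h : nat) (C : nat -> nat -> nat -> set G) (root : nat -> 'I_h) P :
  (forall l, (l < m)%N -> compact_open_multisection s r mul h (C l)) ->
  (forall l v, (l < m)%N -> C l (root l) (root l) v ->
     folner_tile s r mul K d (Tower (C l) (root l) [set: 'I_h]%SET) v) ->
  tiling s r mul e K d P ->
  exists Q, [/\ tiling s r mul e K d Q, covered P `<=` covered Q &
    forall l u, (l < m)%N -> C l (root l) (root l) u -> e * h%:R <=
      (count (fun i => u \in preimage_level s r (C l) i (root l) (covered Q))
        (enum 'I_h))%:R].
Proof.
move=> + + tilP; elim: m => [|m IH] coC folC; first by exists P; split.
have [||Q [tilQ PQ countQ]] := IH.
- by move=> l lm; apply: coC; rewrite (ltn_trans lm).
- by move=> l v lm; apply: folC; rewrite (ltn_trans lm).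
have [Q' [tilQ' QQ' countQ']] :=
  place_column (coC m (ltnSn m)) (fun v => folC m v (ltnSn m)) tilQ.
exists Q'; split=> //; first exact: subset_trans QQ'.
move=> l u; rewrite ltnS leq_eqVlt => /orP[/eqP -> | lm]; first exact: countQ'.
move=> Cu; apply: (le_trans (countQ l u lm Cu)); rewrite ler_nat.
apply: sub_count => i /set_mem[c [Cc Qc] cu]; apply: mem_set.
by exists c => //; split=> //; exact: QQ'.
Qed.

End Placement.

(** * Measure gained in one stage *)

Section Gain.
Set Implicit Arguments.
Unset Strict Implicit.
Context (G : ptopologicalType) (s r : G -> G) (mul : G -> G -> G) (inv : G -> G).
Hypothesis HG : ample_groupoid s r mul inv.
Context (R : realType) (mu : probability (BorelG G) R).
Hypothesis muP : invariant_measures s r mu.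
Context (m h : nat) (C : nat -> nat -> nat -> set G) (root : nat -> 'I_h).
Hypothesis coC : forall l, (l < m)%N -> compact_open_multisection s r mul h (C l).
Hypothesis base_disj : forall (l l' : 'I_m) u,
  C l (root l) (root l) u -> C l' (root l') (root l') u -> l = l'.
Context (eps : R) (f : 'I_m -> 'I_h -> 'I_h).
Hypothesis f_inj : forall l, injective (f l).
Hypothesis levels_large : forall t,
  1 - eps <= mass mu (\bigcup_(l in [set: 'I_m]) C l (f l t) (f l t)).

Let mea (A : set G) : compact_open_set A -> measurable (A : set (BorelG G)).
Proof. exact: measurable_compact_open. Qed.

Let coL (l : 'I_m) (i j : 'I_h) : compact_open_set (C l i j).
Proof. exact: (compact_open_ms (coC (ltn_ord l))). Qed.

Lemma mass_le1 (A : set G) : compact_open_set A -> mass mu A <= 1.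
Proof.
by move=> coA; rewrite -lee_fin massE; [apply: probability_le1; exact: mea | exact: mea].
Qed.

(** For fixed [t] the levels of different columns may overlap, but only slightly: their masses add
    up to at most 1, being those of the disjoint bases, while their union has mass at least
    [1 - eps]. Outside [U] the sum is at least the mass of the union there, and subtraction gives
    the bound inside [U]. *)
Lemma sum_mass_slice (U : set G) (t : 'I_h) : compact_open_set U ->
  \sum_(l < m) mass mu (C l (f l t) (f l t) `&` U) <= mass mu U + eps.
Proof.
move=> coU; set V := \bigcup_(l in [set: 'I_m]) C l (f l t) (f l t).
have coV : compact_open_set V.
  by apply: compact_open_bigcup => //; exact: finite_finset.
have sum1 : \sum_(l < m) mass mu (C l (f l t) (f l t)) <= 1.
  under eq_bigr => l _ do rewrite (mass_level HG muP (f l t) (root l) (coC (ltn_ord l))).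
  have coB : compact_open_set (\bigcup_(l in [set: 'I_m]) C l (root l) (root l)).
    by apply: compact_open_bigcup => //; exact: finite_finset.
  apply: le_trans (mass_le1 coB); apply: mass_bigcup_ge.
  - exact: mea.
  - by move=> l; apply: mea.
  - exact: index_enum_uniq.
  - by move=> l x Cx; exists l.
  - exact: base_disj.
have sumD : mass mu (V `\` U) <= \sum_(l < m) mass mu (C l (f l t) (f l t) `\` U).
  apply: mass_bigcup_le.
  - by apply: mea; apply: (compact_openD HG).
  - by move=> l; apply: mea; apply: (compact_openD HG).
  - by move=> x [[l _ Cx] Ux]; exists l => //; rewrite mem_index_enum.
have VU : mass mu V <= mass mu U + mass mu (V `\` U).
  rewrite (mass_split mu (mea coV) (mea coU)) lerD2r; apply: mass_le.
  - by apply: mea; apply: (compact_openII HG).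
  - exact: mea.
  - exact: subIsetr.
have := levels_large t; rewrite -/V => V1.
have sumE : \sum_(l < m) mass mu (C l (f l t) (f l t)) =
    \sum_(l < m) mass mu (C l (f l t) (f l t) `&` U) +
    \sum_(l < m) mass mu (C l (f l t) (f l t) `\` U).
  by rewrite -big_split /=; apply: eq_bigr => l _; apply: mass_split; exact: mea.
lra.
Qed.

(** All columns have height [h], so each injection [f l] is a permutation of the levels and the sum
    can be regrouped into [h] slices. *)
Lemma sum_mass_levels (U : set G) : compact_open_set U ->
  \sum_(p : 'I_m * 'I_h) mass mu (C p.1 p.2 p.2 `&` U) <= h%:R * (mass mu U + eps).
Proof.
move=> coU; rewrite -(pair_bigA _ (fun (l : 'I_m) (i : 'I_h) => mass mu (C l i i `&` U))) /=.
under eq_bigr => l _ do rewrite (reindex_inj (@f_inj l)).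
rewrite exchange_big /= mulr_natl -[X in _ *+ X]card_ord -sumr_const.
by apply: ler_sum => t _; apply: sum_mass_slice.
Qed.

Context (e d : R) (K : set G) (P Q : seq (tower G)).
Hypothesis coG0 : compact_open_set (G0 s).
Hypothesis e0 : 0 <= e.
Hypothesis e2 : e <= 2^-1.
Hypothesis d0 : 0 <= d.
Hypothesis base_cover : forall u, G0 s u -> exists l : 'I_m, C l (root l) (root l) u.
Hypothesis invK : forall (l : 'I_m) (i : 'I_h), inv @` C l i (root l) `<=` K.
Hypothesis tilP : tiling s r mul e K d P.
Hypothesis coQ : compact_open_set (covered Q).
Hypothesis QG0 : covered Q `<=` G0 s.
Hypothesis PQ : covered P `<=` covered Q.
Hypothesis countQ : forall (l : 'I_m) u, C l (root l) (root l) u -> e * h%:R <=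
  (count (fun i => u \in preimage_level s r (C l) i (root l) (covered Q))
        (enum 'I_h))%:R.

(** Outside [A], units whose tile meets [A] are bad; their mass is bounded by one escape estimate
    [2 d] for each column and level. Averaging over the remaining units shows that [e] times their
    mass is at most the newly covered mass plus [eps]. *)
Lemma uncovered_gain : (0 < h)%N ->
  mass mu (G0 s `\` covered Q) <=
  (1 - e) * mass mu (G0 s `\` covered P) + (m * h)%:R * (2 * d) + eps.
Proof.
move=> h0; set A := covered P; set A' := covered Q.
have coA : compact_open_set A := compact_open_covered tilP.
have coU : compact_open_set (G0 s `\` A) by exact: (compact_openD HG).
have coA'A : compact_open_set (A' `\` A) by exact: (compact_openD HG).
(* The uncovered units in the base of column [p.1] whose tile has its point of level [p.2] in
   [A]. *)
pose B (p : 'I_m * 'I_h) := s @` (C p.1 p.2 (root p.1) `&`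
  s @^-1` (G0 s `\` A) `&` r @^-1` A).
have coB p : compact_open_set (B p).
  apply: (compact_open_src HG); apply: (compact_openI_rng HG) => //.
  exact: (compact_openI_src HG).
have massB p : mass mu (B p) <= 2 * d.
  apply: (mass_escape HG muP d0 e2 coG0 tilP) => //.
  have [[+ _ _ _] _] := coC (ltn_ord p.1); exact.
pose bad := \bigcup_(p in [set: 'I_m * 'I_h]) B p.
have cobad : compact_open_set bad.
  by apply: compact_open_bigcup => //; exact: finite_finset.
have massbad : mass mu bad <= (m * h)%:R * (2 * d).
  apply: (@le_trans _ _ (\sum_(p : 'I_m * 'I_h) mass mu (B p))).
    apply: mass_bigcup_le; [exact: mea|by move=> p; apply: mea|].
    by move=> x [p _ Bx]; exists p => //; rewrite mem_index_enum.
  apply: (@le_trans _ _ (\sum_(p : 'I_m * 'I_h) 2 * d)); first by apply: ler_sum.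
  by rewrite sumr_const card_prod !card_ord -[leLHS]mulr_natl.
pose good := (G0 s `\` A) `\` bad.
have cogood : compact_open_set good by exact: (compact_openD HG).
have good_count : e * h%:R * mass mu good <= h%:R * (mass mu (A' `\` A) + eps).
  apply: le_trans (sum_mass_levels coA'A).
  under eq_bigr => p _ do
    rewrite -(mass_preimage_level HG muP p.2 (root p.1) (coC (ltn_ord p.1)) coA'A).
  apply: mass_count_ge.
  - exact: mea.
  - move=> p; apply: mea; apply: (compact_open_preimage_level HG) => //.
    exact: coC.
  - by rewrite mulr_ge0.
  move=> u [[G0u Au] nbad]; have [l Cu] := base_cover G0u.
  apply: (le_trans (countQ Cu)).
  have -> : \sum_(p : 'I_m * 'I_h)
      (\1_(preimage_level s r (C p.1) p.2 (root p.1) (A' `\` A)) u : R) =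
    \sum_(l < m) \sum_(i < h) (\1_(preimage_level s r (C l) i (root l) (A' `\` A)) u).
    by rewrite pair_bigA.
  (* Only the column over [u] is retained from the sum. As [u] is not bad, no point of its tile lies
     in [A], so every point counted in [A'] lies in [A' \ A]. *)
  rewrite (bigD1 l) //= -[leLHS]addr0; apply: lerD; last first.
    by apply: sumr_ge0 => l' _; apply: sumr_ge0 => i _; rewrite indicE.
  rewrite -big_enum /=. rewrite sum_indic ler_nat; apply: sub_count => i /set_mem[c [Cc A'c] cu].
  apply: mem_set; exists c => //; split=> //; split=> // Ac.
  apply: nbad; exists (l, i) => //; exists c => //; split=> //; split=> //.
  by rewrite /= cu.
have massgood : e * mass mu good <= mass mu (A' `\` A) + eps.
  by move: good_count; rewrite [e * _]mulrC -mulrA ler_pM2l ?ltr0n.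
have splitgood : mass mu (G0 s `\` A) <= mass mu good + mass mu bad.
  rewrite (mass_split mu (mea coU) (mea cobad)) addrC lerD2l; apply: mass_le.
  - by apply: mea; apply: (compact_openII HG).
  - exact: mea.
  - exact: subIsetr.
have splitA' : mass mu (G0 s `\` A) = mass mu (A' `\` A) + mass mu (G0 s `\` A').
  rewrite (mass_split mu (mea coU) (mea coQ)); congr (mass mu _ + mass mu _).
    by apply/seteqP; split=> [x [[_ Ax] A'x]|x [A'x Ax]]; split=> //; split=> //; exact: QG0.
  by apply/seteqP; split=> [x [[G0x _] A'x]|x [G0x A'x]]; split=> //; split=> // /PQ.
have e_split := ler_wpM2l e0 splitgood.
have e_bad : e * mass mu bad <= mass mu bad.
  by rewrite ler_piMl ?mass_ge0 //; apply: le_trans e2 _; lra.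
rewrite mulrDr in e_split; rewrite mulrBl mul1r; lra.
Qed.

End Gain.

(** * The groupoid of a tiling *)

Section TilingGroupoid.
Set Implicit Arguments.
Unset Strict Implicit.
Context (G : ptopologicalType) (s r : G -> G) (mul : G -> G -> G) (inv : G -> G).
Hypothesis HG : ample_groupoid s r mul inv.
Context (R : realType) (e : R) (K : set G) (d : R) (P : seq (tower G)).
Hypothesis tilP : tiling s r mul e K d P.

(** Default value for [nth]; a tower has a root, so the least possible height is 1. *)
Let tw0 : tower G := Tower (fun _ _ => set0) (@ord0 0) finset.set0.
Let T q := nth tw0 P q.
(** Kept levels are renumbered consecutively, since the levels of a castle are indexed by an initial
    segment of the integers. *)
Let kept_index q (i : nat) : nat := nth 0%N (map val (enum (tw_kept (T q)))) i.
Let C q i j : set G := tw_C (T q) (kept_index q i) (kept_index q j).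
Let k q := #|tw_kept (T q)|.

Definition tiling_groupoid : set G :=
  \bigcup_(q in [set q | (q < size P)%N])
    \bigcup_(p in [set p : nat * nat | (p.1 < k q)%N /\ (p.2 < k q)%N]) C q p.1 p.2.

Let size_kept q : size (map val (enum (tw_kept (T q)))) = k q.
Proof. by rewrite size_map -cardE. Qed.

Let kept_indexP q i : (i < k q)%N -> exists2 a, a \in tw_kept (T q) & kept_index q i = val a.
Proof.
move=> ik; have := mem_nth 0%N (s := map val (enum (tw_kept (T q)))) (n := i).
rewrite size_kept => /(_ ik) /mapP[a]; rewrite mem_enum => ak ai.
by exists a.
Qed.

Let kept_index_ex q (a : 'I_(tw_h (T q))) : a \in tw_kept (T q) ->
  exists2 i, (i < k q)%N & kept_index q i = val a.
Proof.
move=> ak; have ak' : val a \in map val (enum (tw_kept (T q))).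
  by apply: map_f; rewrite mem_enum.
exists (index (val a) (map val (enum (tw_kept (T q))))).
  by rewrite -size_kept index_mem.
exact: nth_index.
Qed.

Let kept_index_lt q i : (i < k q)%N -> (kept_index q i < tw_h (T q))%N.
Proof. by move=> /kept_indexP[a _ ->]; exact: ltn_ord. Qed.

Let kept_index_inj q i j : (i < k q)%N -> (j < k q)%N ->
  kept_index q i = kept_index q j -> i = j.
Proof.
move=> ik jk /eqP; rewrite nth_uniq ?size_kept // => [/eqP //|].
by rewrite map_inj_uniq ?enum_uniq //; exact: val_inj.
Qed.

Let good_T q : (q < size P)%N -> good_tower s r mul e K d (T q).
Proof.
rewrite /T; elim: P tilP q => // p P' IH /= [gp _ _ tilP'] [|q] //=.
exact: IH.
Qed.

Lemma covered_nth y : covered P y <-> exists2 q, (q < size P)%N & kept_levels (T q) y.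
Proof.
rewrite /T; elim: P => [|p P' IH] /=; first by split=> [//|[]].
split=> [[py|/IH[q qP' qy]]|[[|q] qP' qy]].
- by exists 0%N.
- by exists q.+1.
- by left.
- by right; apply/IH; exists q.
Qed.

Let kept_disj q q' y : (q < size P)%N -> (q' < size P)%N ->
  kept_levels (T q) y -> kept_levels (T q') y -> q = q'.
Proof.
suff lt_disj a b : (a < b < size P)%N -> kept_levels (T a) y -> kept_levels (T b) y -> False.
  move=> qP q'P qy q'y; case: (ltngtP q q') => // [lt|lt]; exfalso.
    by apply: lt_disj qy q'y; rewrite lt.
  by apply: lt_disj q'y qy; rewrite lt.
rewrite /T; elim: P tilP a b => [|p P' IH] /=; first by move=> _ a b /andP[].
move=> [_ disj _ tilP'] [|a] [|b] //=; last exact: IH.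
rewrite ltnS => bP' py by_.
have : (kept_levels p `&` covered P') y.
  split=> //; elim: P' b bP' by_ {IH disj tilP'} => //= p' P' IH [|b] bP' by_; first by left.
  by right; exact: IH bP' by_.
by rewrite disj.
Qed.

Let tgP x : tiling_groupoid x <-> exists q (i j : 'I_(tw_h (T q))),
  [/\ (q < size P)%N, i \in tw_kept (T q), j \in tw_kept (T q) & tw_C (T q) i j x].
Proof.
split=> [[q qP [[a b] /= [ak bk] Cx]]|[q [i [j [qP ik jk Cx]]]]].
  have [i ik ai] := kept_indexP ak; have [j jk bj] := kept_indexP bk.
  by exists q, i, j; split=> //; move: Cx; rewrite /C ai bj.
have [a ak ai] := kept_index_ex ik; have [b bk bj] := kept_index_ex jk.
by exists q => //; exists (a, b) => //=; rewrite /C ai bj.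
Qed.

(** Kept levels of different towers are disjoint, and so are the levels of one tower. The indices
    are compared through [val] because their types depend on the tower. *)
Let level_uniq q q' (i : 'I_(tw_h (T q))) (i' : 'I_(tw_h (T q'))) y :
  (q < size P)%N -> (q' < size P)%N -> i \in tw_kept (T q) -> i' \in tw_kept (T q') ->
  tw_C (T q) i i y -> tw_C (T q') i' i' y -> q = q' /\ val i = val i'.
Proof.
move=> qP q'P ik ik' Cy Cy'.
have qq' : q = q' by apply: (kept_disj (y := y)) => //; [exists i | exists i'].
split=> //; case: _ / qq' in i' q'P ik' Cy' *.
by have [[mC _] _ _] := good_T qP; rewrite (ms_disj mC Cy Cy').
Qed.

Let compact_open_C q i j : (q < size P)%N -> (i < k q)%N -> (j < k q)%N ->
  compact_open_set (C q i j).
Proof.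
move=> qP ik jk; have [coC _ _] := good_T qP.
exact: (compact_open_ms coC (Ordinal (kept_index_lt ik)) (Ordinal (kept_index_lt jk))).
Qed.

Let src_level q i j x : (q < size P)%N -> (i < k q)%N -> (j < k q)%N ->
  C q i j x -> C q j j (s x).
Proof.
move=> qP ik jk; have [[mC _] _ _] := good_T qP.
exact: (ms_src HG mC (i := Ordinal (kept_index_lt ik)) (j := Ordinal (kept_index_lt jk))).
Qed.

Let rng_level q i j x : (q < size P)%N -> (i < k q)%N -> (j < k q)%N ->
  C q i j x -> C q i i (r x).
Proof.
move=> qP ik jk; have [[mC _] _ _] := good_T qP.
exact: (ms_rng HG mC (i := Ordinal (kept_index_lt ik)) (j := Ordinal (kept_index_lt jk))).
Qed.

Let C_level_uniq q q' i i' y : (q < size P)%N -> (q' < size P)%N ->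
  (i < k q)%N -> (i' < k q')%N -> C q i i y -> C q' i' i' y -> q = q' /\ i = i'.
Proof.
move=> qP q'P ik ik' Cy Cy'.
have [a ak ai] := kept_indexP ik; have [b bk bi] := kept_indexP ik'.
rewrite /C ai in Cy; rewrite /C bi in Cy'.
have [qq' ab] := level_uniq qP q'P ak bk Cy Cy'; split=> //.
move: ik' bi; rewrite -ab -ai -qq' => ik' /esym; exact: kept_index_inj.
Qed.

(** The source of an arrow determines its tower and its source level, and likewise for the range.
    Hence composable arrows belong to one tower and share the middle level, which gives closure
    under products and the castle condition. *)
Lemma elementary_tiling_groupoid : elementary s r mul inv tiling_groupoid.
Proof.
have [compH openH] : compact_open_set tiling_groupoid.
  apply: compact_open_bigcup => [|q qP]; first exact: finite_II.
  apply: compact_open_bigcup => [|[i j] /= [ik jk]]; last exact: compact_open_C.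
  exact: (@finite_setX _ _ `I_(k q) `I_(k q)).
split=> //.
  split=> [a b|a].
    move=> /tgP[q [i [j [qP ik jk Ca]]]] /tgP[q' [i' [j' [q'P ik' jk' Cb]]]] ab.
    have [[mC _] _ _] := good_T qP; have [[mC' _] _ _] := good_T q'P.
    have Csa := ms_src HG mC Ca; rewrite ab in Csa.
    have [qq' ji'] := level_uniq qP q'P jk ik' Csa (ms_rng HG mC' Cb).
    case: _ / qq' in i' j' q'P ik' jk' Cb mC' ji' *.
    apply/tgP; exists q, i, j'; split=> //.
    by rewrite -ji' in Cb; exact: (ms_mul mC Ca Cb).
  move=> /tgP[q [i [j [qP ik jk Ca]]]]; have [[mC _] _ _] := good_T qP.
  by apply/tgP; exists q, j, i; split=> //; exact: (ms_inv HG mC Ca).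
exists (size P), k, C; split=> //.
  split=> [q qP|q q' i j i' j' qP q'P qq' ik jk ik' jk'].
    have [coC _ _] := good_T qP.
    by apply: (compact_open_reindex coC); [exact: kept_index_lt | exact: kept_index_inj].
  apply/seteqP; split=> // x [a [b [Ca Cb ab _]]].
  have := src_level qP ik jk Ca; rewrite ab => Cs.
  by case: (C_level_uniq qP q'P jk ik' Cs (rng_level q'P ik' jk' Cb)).
move=> q q' i j i' j' qP q'P ik jk ik' jk' neq; apply/seteqP; split=> // x [Cx Cx'].
have [qq' jj'] := C_level_uniq qP q'P jk jk' (src_level qP ik jk Cx) (src_level q'P ik' jk' Cx').
have [_ ii'] := C_level_uniq qP q'P ik ik' (rng_level qP ik jk Cx) (rng_level q'P ik' jk' Cx').
by apply: neq; rewrite qq' ii' jj'.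
Qed.

Lemma unitspace_tiling_groupoid : unitspace s tiling_groupoid = covered P.
Proof.
apply/seteqP; split=> [x [/tgP[q [i [j [qP ik jk Cx]]]] G0x]|x].
  apply/covered_nth; exists q => //; exists i => //=; have [[mC _] _ _] := good_T qP.
  by have := ms_rng HG mC Cx; rewrite (G0_rng HG G0x).
move=> /covered_nth[q qP [i /= ik Cx]]; split; first by apply/tgP; exists q, i, i.
by have [[[_ _ C0 _] _] _ _] := good_T qP; apply: (C0 i).
Qed.

(* Right translation by an element c from the root to the level of u compares
   the fibre over u with the tile at s c. *)
Lemma folner_tiling_groupoid (t : R) u : e <= 4^-1 -> 0 < t -> d + e <= t / 2 ->
  unitspace s tiling_groupoid u ->
  [/\ finite_set (fib s tiling_groupoid u),
      finite_set (setmul s r mul K (fib s tiling_groupoid u) `\` fib s tiling_groupoid u) &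
      (Defs.card (setmul s r mul K (fib s tiling_groupoid u) `\` fib s tiling_groupoid u))%:R
        < t * (Defs.card (fib s tiling_groupoid u))%:R].
Proof.
move=> e4 t0 de; rewrite unitspace_tiling_groupoid => /covered_nth[q qP [i /= ik Cu]].
have [[mC _] keptp fol] := good_T qP.
have fibP x : fib s tiling_groupoid u x <->
    exists2 a, a \in tw_kept (T q) & tw_C (T q) a i x /\ s x = u.
  split=> [[/tgP[q' [a [j [q'P ak jk Cx]]]] xu]|[a ak [Cx xu]]]; last first.
    by split=> //; apply/tgP; exists q, a, i.
  have [[mC' _] _ _] := good_T q'P.
  have := ms_src HG mC' Cx; rewrite xu => Cu'.
  have [qq' ij] := level_uniq qP q'P ik jk Cu Cu'.
  case: _ / qq' in a j q'P ak jk Cx ij mC' Cu' *.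
  by exists a => //; rewrite (val_inj ij).
have [finH _] : finite_set (fib s tiling_groupoid u) /\
    (Defs.card (fib s tiling_groupoid u) <= size (enum (tw_kept (T q))))%N.
  apply: (@card_le_size _ _ _ (fun (a : 'I_(tw_h (T q))) x => tw_C (T q) a i x /\ s x = u)).
    by move=> x /fibP[a ak ax]; exists a => //; rewrite mem_enum.
  by move=> a x x' _ _ [Cx xu] [Cx' x'u]; apply: (ms_inj_src mC Cx Cx'); rewrite xu.
have keptH : (k q <= Defs.card (fib s tiling_groupoid u))%N.
  rewrite /k cardE.
  apply: (@size_le_card _ _ _ (fun (a : 'I_(tw_h (T q))) x => tw_C (T q) a i x)) => //.
  - exact: enum_uniq.
  - move=> a; rewrite mem_enum => ak; have [x Cx xu] := ms_ex_src HG mC a Cu.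
    by exists x => //; apply/fibP; exists a.
  - move=> a b x _ _ Cx Cx'; apply: (ms_disj mC (ms_rng HG mC Cx)).
    exact: (ms_rng HG mC Cx').
have [c Cc cu] := ms_ex_rng HG mC (tw_root (T q)) Cu.
have [finK cardK] := fol _ (ms_src HG mC Cc).
set v := s c in finK cardK.
(* The points of the tile at [v] in discarded levels, at most [e h] in number. *)
pose lost := [set x | exists2 a : 'I_(tw_h (T q)), a \notin tw_kept (T q) &
  tw_C (T q) a (tw_root (T q)) x /\ s x = v].
have [finL cardL] : finite_set lost /\
    (Defs.card lost <= size (enum (~: tw_kept (T q))%SET))%N.
  apply: (@card_le_size _ _ _ (fun (a : 'I_(tw_h (T q))) x =>
    tw_C (T q) a (tw_root (T q)) x /\ s x = v)).
    by move=> x [a ak ax]; exists a => //; rewrite mem_enum finset.in_setC.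
  by move=> a x x' _ _ [Cx xu] [Cx' x'u]; apply: (ms_inj_src mC Cx Cx'); rewrite xu.
have [finU cardU] := card_setU_le finK finL.
set F := fib s tiling_groupoid u in fibP finH keptH *.
have [finD cardD] : finite_set (setmul s r mul K F `\` F) /\
    (Defs.card (setmul s r mul K F `\` F) <=
     Defs.card ((setmul s r mul K (tile s (T q) v) `\` tile s (T q) v) `|` lost))%N.
  have src_KF x : (setmul s r mul K F `\` F) x -> s x = r c.
    by move=> [[a [b [Ka /fibP[_ _ [_ bu]] ab ->]]] _]; rewrite (src_mul HG) // bu.
  apply: (@card_inj_le _ (mul ^~ c)) => //; last first.
    by move=> x y /src_KF xc /src_KF yc; exact: (gmulIr HG xc yc).
  move=> x KFx; have xc := src_KF _ KFx; case: KFx => -[a [b [Ka Fb ab xab]]] nFx.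
  have /fibP[a' a'k [Cb bu]] := Fb.
  have bc : s b = r c by rewrite bu.
  have Cbc := ms_mul mC Cb Cc bc.
  (* Either [x c] has left the tile, or it lies in some level [j] of it; that level is discarded,
     since otherwise [x] would belong to the fibre. *)
  have [[j Cxc sxc]|ntile] := pselect (tile s (T q) v (mul x c)); last first.
    left; split=> //; exists a, (mul b c); split=> //.
    - by exists a' => //; rewrite (src_mul HG).
    - by rewrite (rng_mul HG).
    - by rewrite xab (gmulA HG).
  right; exists j => //; apply/negP => jk; apply: nFx; apply/fibP; exists j => //.
  split; last by rewrite xc.
  rewrite -(gmulKr HG xc); apply: (ms_mul mC Cxc (ms_inv HG mC Cc)).
  by rewrite (src_mul HG) // (rng_inv HG).
split=> //.
have h0 : 0 < (tw_h (T q))%:R :> R.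
  by rewrite ltr0n; case: (tw_root (T q)) => a; exact: leq_ltn_trans.
have := cardsC (tw_kept (T q)); rewrite card_ord => /(congr1 (fun n => n%:R : R)).
rewrite natrD => keptC.
have cardD' := leq_trans cardD cardU.
rewrite -(ler_nat R) natrD in cardD'.
rewrite -(ler_nat R) -cardE in cardL.
rewrite -(ler_nat R) in keptH; rewrite /k in keptH.
(* The count to be assembled is [(d + e) h <= (t / 2) h < (3 / 4) t h <= t (1 - e) h <= t |F|],
   where [e <= 1/4] gives the third inequality. *)
have : t * #|tw_kept (T q)|%:R <= t * (Defs.card F)%:R by rewrite ler_pM2l.
have : t * ((1 - e) * (tw_h (T q))%:R) <= t * #|tw_kept (T q)|%:R by rewrite ler_pM2l.
have : t * (3 / 4 * (tw_h (T q))%:R) <= t * ((1 - e) * (tw_h (T q))%:R).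
  by rewrite ler_pM2l // ler_pM2r //; lra.
have : (d + e) * (tw_h (T q))%:R <= t / 2 * (tw_h (T q))%:R by rewrite ler_pM2r.
have : 0 < t * (tw_h (T q))%:R by rewrite mulr_gt0.
rewrite -/v in cardK.
lra.
Qed.

End TilingGroupoid.

(** * Existence of tilings *)

Section Existence.
Set Implicit Arguments.
Unset Strict Implicit.
Context (G : ptopologicalType) (s r : G -> G) (mul : G -> G -> G) (inv : G -> G).
Hypothesis HG : ample_groupoid s r mul inv.
Context (R : realType).

Lemma height_le (D : normal_data G) l : (l < nd_m D)%N -> (height D <= nd_k D l)%N.
Proof.
move=> lm; rewrite /height.
have : Ordinal lm \in index_enum 'I_(nd_m D) by rewrite mem_index_enum.
elim: (index_enum _) => // i js IH; rewrite inE big_cons => /orP[/eqP <-|/IH le_js].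
  exact: geq_minl.
exact: leq_trans (geq_minr _ _) le_js.
Qed.

Lemma invariant_mass_ge (mu : probability (BorelG G) R) (A : set G) (c : R) :
  invariant_measures s r mu -> compact_open_set A ->
  (c%:E <= inf_measure s r R A)%E -> c <= mass mu A.
Proof.
move=> muP coA cA; rewrite -lee_fin massE; last exact: measurable_compact_open.
by apply: (le_trans cA); apply: ereal_inf_lbound; exists mu.
Qed.

(* Condition (a) for columns of common height h, with eta in place of eps_n. *)
Definition columns (K : set G) (d eta : R) (m h : nat)
    (C : nat -> nat -> nat -> set G) (root : nat -> 'I_h) (f : 'I_m -> 'I_h -> 'I_h) :=
  [/\ forall l, (l < m)%N -> compact_open_multisection s r mul h (C l),
      forall (l l' : 'I_m) u, C l (root l) (root l) u -> C l' (root l') (root l') u -> l = l',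
      forall u, G0 s u -> exists l : 'I_m, C l (root l) (root l) u,
      forall l v, (l < m)%N -> C l (root l) (root l) v ->
        folner_tile s r mul K d (Tower (C l) (root l) [set: 'I_h]%SET) v &
      (forall l, injective (f l)) /\
      forall (mu : probability (BorelG G) R), invariant_measures s r mu -> forall t,
        1 - eta <= mass mu (\bigcup_(l in [set: 'I_m]) C l (f l t) (f l t))].

(** One index [n] is taken far enough out for both the Følner estimate and [eps n <= eta]. The
    height is a minimum, so 1-controlled height makes every column exactly that high. *)
Lemma columns_of_folner_sequence M (eps : nat -> R) S D :
  eps @ \oo --> 0 -> folner_sequence s r mul R S D ->
  (forall n, good s r M (eps n) (D n)) -> (forall n, controlled_height 1 (D n)) ->
  forall K : set G, compact K -> forall d eta : R, 0 < d -> 0 < eta ->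
  exists m h C (root : nat -> 'I_h) (f : 'I_m -> 'I_h -> 'I_h), (0 < h)%N /\
    columns K d eta C root f.
Proof.
move=> eps0 [normS folS] goodD heightD K cK d eta d0 eta0.
have [n [folSn epsn]] : exists n, (forall u, G0 s u ->
      [/\ finite_set (fib s (S n) u),
          finite_set (setmul s r mul K (fib s (S n) u) `\` fib s (S n) u) &
          ((Defs.card (setmul s r mul K (fib s (S n) u) `\` fib s (S n) u))%:R
             <= d * (Defs.card (fib s (S n) u))%:R)]) /\ eps n <= eta.
  have small : \forall n \near \oo, eps n <= eta.
    have /cvgrPdist_le/(_ _ eta0) := eps0; apply: filterS => n.
    by rewrite sub0r normrN; apply: le_trans; exact: ler_norm.
  have [n _ Hn] := filterI (folS K cK d d0) small.
  by exists n; apply: (Hn n) => /=.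
have [_ coC rootlt SE [_ G0E base_disj]] := normS n.
have [f [fP large _]] := goodD n.
set Dn := D n in coC rootlt SE G0E base_disj fP large; set h := height Dn in fP large.
have kE l : (l < nd_m Dn)%N -> nd_k Dn l = h.
  move=> lm; apply/eqP; rewrite eqn_leq height_le // andbT.
  by have := heightD n _ lm; rewrite mul1n.
(* [G] is pointed, so there is a unit, and the column over it has a root index below [h]. *)
have h0 : (0 < h)%N.
  have : G0 s (s point) by exact: G0_s.
  by rewrite G0E => -[l /= lm _]; rewrite -(kE l lm); exact: leq_ltn_trans (rootlt l lm).
pose ord (i : nat) : 'I_h := insubd (Ordinal h0) i.
have ordE i : (i < h)%N -> val (ord i) = i by move=> ih; rewrite /ord val_insubd ih.
pose root l := ord (nd_i0 Dn l).
have rootE l : (l < nd_m Dn)%N -> val (root l) = nd_i0 Dn l.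
  by move=> lm; apply: ordE; rewrite -(kE l lm) rootlt.
exists (nd_m Dn), h, (nd_C Dn), root, (fun l t => ord (f l t)); split=> //.
have fE (l : 'I_(nd_m Dn)) (t : 'I_h) : val (ord (f l t)) = f l t.
  by apply: ordE; have [+ _ _] := fP l (ltn_ord l); rewrite kE //; apply.
have disj (l l' : nat) u : (l < nd_m Dn)%N -> (l' < nd_m Dn)%N ->
    nd_C Dn l (root l) (root l) u -> nd_C Dn l' (root l') (root l') u -> l = l'.
  move=> lm l'm; rewrite !rootE // => Cu Cu'; apply: contrapT => ll'.
  by have := base_disj l l' lm l'm ll'; apply/eqP/set0P; exists u.
have coCh l : (l < nd_m Dn)%N -> compact_open_multisection s r mul h (nd_C Dn l).
  by move=> lm; have := coC l lm; rewrite kE.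
split=> //.
- by move=> l l' u Cu Cu'; apply/val_inj; exact: disj Cu Cu'.
- by move=> u; rewrite G0E => -[l lm Cu]; exists (Ordinal lm); rewrite /= rootE.
- move=> l v lm Cv; have [mC _] := coCh l lm.
  have G0v : G0 s v by have [_ _ C0 _] := mC; apply: (C0 (root l)).
  have [finF finK cardK] := folSn v G0v.
  (* The bases partition the units, so column [l] alone contributes to the fibre over [v]. *)
  have tileE : fib s (S n) v = tile s (Tower (nd_C Dn l) (root l) [set: 'I_h]%SET) v.
    rewrite SE; apply/seteqP; split=> [x [[l' /= l'm [i /= ik Cx]] xv]|x [i /= Cx xv]].
      rewrite -(rootE l' l'm) in Cx; rewrite (kE l' l'm) in ik.
      have [mC' _] := coCh l' l'm.
      have := ms_src HG mC' (i := Ordinal ik) Cx; rewrite xv => Cv'.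
      have ll' := disj _ _ _ lm l'm Cv Cv'; rewrite -ll' in Cx.
      by exists (Ordinal ik).
    split=> //; exists l => //; exists (val i) => /=; first by rewrite kE.
    by rewrite -rootE.
  rewrite /folner_tile -tileE /=; split=> //; apply: (le_trans cardK).
  rewrite ler_wpM2l ?(ltW d0) // ler_nat -[X in (_ <= X)%N]size_enum_ord.
  rewrite tileE; apply: (@card_le_size _ _ _ (fun (i : 'I_h) x =>
    nd_C Dn l i (root l) x /\ s x = v) _ _ _).2.
    by move=> x [i Cx xv]; exists i; rewrite ?mem_enum.
  by move=> i x x' _ _ [Cx xv] [Cx' x'v]; apply: (ms_inj_src mC Cx Cx'); rewrite xv.
- split=> [l t t' /(congr1 val)|mu muP t].
    have [_ f_inj _] := fP l (ltn_ord l).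
    by rewrite /= !fE => /f_inj ftt'; apply/val_inj/ftt'.
  have -> : \bigcup_(l in [set: 'I_(nd_m Dn)]) nd_C Dn l (ord (f l t)) (ord (f l t)) =
      \bigcup_(l in [set l | (l < nd_m Dn)%N]) nd_C Dn l (f l t) (f l t).
    apply/seteqP; split=> [x [l _]|x [l /= lm Cx]]; first by rewrite fE; exists l => /=.
    by exists (Ordinal lm) => //; rewrite fE.
  apply: (@le_trans _ _ (1 - eps n)); first by rewrite lerD2l lerN2.
  apply: (invariant_mass_ge muP); last exact: large.
  apply: compact_open_bigcup => [|l /= lm]; first exact: finite_II.
  have ft : (f l t < h)%N by have [+ _ _] := fP l lm; rewrite kE //; apply.
  exact: (compact_open_ms (coCh l lm) (Ordinal ft) (Ordinal ft)).
Qed.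

(* The last stage is chosen first, so that the tiles placed before it can be
   taken to be invariant under the inverses of its columns. *)
Lemma tiling_exists (e eta : R) : compact_open_set (G0 s) ->
  0 <= e -> e <= 2^-1 -> 0 < eta ->
  (forall K : set G, compact K -> forall d eta : R, 0 < d -> 0 < eta ->
    exists m h C (root : nat -> 'I_h) (f : 'I_m -> 'I_h -> 'I_h), (0 < h)%N /\
      columns K d eta C root f) ->
  forall (N : nat) (K : set G) (d : R), compact K -> 0 < d ->
  exists2 P, tiling s r mul e K d P &
    forall mu : probability (BorelG G) R, invariant_measures s r mu ->
      mass mu (G0 s `\` covered P) <= (1 - e) ^+ N + N%:R * eta.
Proof.
move=> coG0 e0 e2 eta0 colP; elim=> [|N IH] K d cK d0.
  exists [::] => // mu muP; rewrite expr0 mul0r addr0; apply: mass_le1.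
  by apply: (compact_openD HG) => //; exact: compact_open0.
have eta20 : 0 < eta / 2 by rewrite divr_gt0.
have [m [h [C [root [f [h0 [coC base_disj base_cover folC [f_inj large]]]]]]]] :=
  colP K cK d (eta / 2) d0 eta20.
pose K' := K `|` \bigcup_(p in [set: 'I_m * 'I_h]) inv @` C p.1 p.2 (root p.1).
have cK' : compact K'.
  apply: compactU => //.
  have -> : \bigcup_(p in [set: 'I_m * 'I_h]) inv @` C p.1 p.2 (root p.1) =
      inv @` \bigcup_(p in [set: 'I_m * 'I_h]) C p.1 p.2 (root p.1).
    by rewrite image_bigcup.
  apply: (compact_inv HG); apply: (compact_open_bigcup _ _).1; first exact: finite_finset.
  by move=> p _; exact: (compact_open_ms (coC _ (ltn_ord p.1))).
have mh0 : 0 < 4 * (m * h).+1%:R :> R by rewrite mulr_gt0.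
(* The total escape [(m h) 2 d'] is to be at most [eta / 2], the other half of [eta] being the error
   of the level maps. The successor in the denominator keeps it positive. *)
pose d' := Num.min d (eta / (4 * (m * h).+1%:R)).
have d'0 : 0 < d' by rewrite lt_min d0 divr_gt0.
have [P tilP massP] := IH K' d' cK' d'0.
have tilPK : tiling s r mul e K d P.
  by apply: tiling_mono tilP; [exact: subsetUl | rewrite ge_min lexx].
have e1 : e <= 1 by apply: le_trans e2 _; lra.
have [Q [tilQ PQ countQ]] := place_columns HG e1 coC folC tilPK.
exists Q => // mu muP.
have coQ := compact_open_covered tilQ; have QG0 := covered_G0 tilQ.
have invK (l : 'I_m) (i : 'I_h) : inv @` C l i (root l) `<=` K'.
  by move=> x Cx; right; exists (l, i).
have gain := uncovered_gain HG muP coC base_disj f_inj (large mu muP) coG0 e0 e2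
  (ltW d'0) base_cover invK tilP coQ QG0 PQ (fun l u => countQ l u (ltn_ord l)) h0.
have d'eta : (m * h)%:R * (2 * d') <= eta / 2.
  have d'le : d' * (4 * (m * h).+1%:R) <= eta.
    by rewrite -ler_pdivlMr // ge_min lexx orbT.
  by move: d'le; rewrite -[(m * h).+1%:R]natr1; nra.
have massP1 := massP mu muP.
have e10 : 0 <= 1 - e by rewrite subr_ge0.
(* One stage turns [(1 - e)^N + N eta] into at most [(1 - e)^(N+1) + N eta + eta / 2 + eta / 2]. *)
have step := ler_wpM2l e10 massP1; rewrite mulrDr -exprS in step.
have Neta : (1 - e) * (N%:R * eta) <= N%:R * eta.
  by apply: ler_piMl; [rewrite mulr_ge0 ?(ltW eta0) | lra].
rewrite -[N.+1%:R]natr1; lra.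
Qed.

End Existence.

(** * Choice of the constants and conclusion *)

Theorem theoremA (G : ptopologicalType) (s r : G -> G) (mul : G -> G -> G)
  (inv : G -> G) (R : realType) (M : nat) (eps : nat -> R) :
  ample_groupoid s r mul inv ->
  (forall n m, (n <= m)%N -> eps m <= eps n) ->
  (forall n, 0 < eps n) ->
  eps @ \oo --> 0 ->
  (exists (S : nat -> set G) (D : nat -> normal_data G),
     [/\ folner_sequence s r mul R S D,
         forall n, good s r M (eps n) (D n) &
         forall n, controlled_height 1 (D n)]) ->
  almost_finite_in_measure s r mul inv R.
Proof.
move=> HG _ _ eps0 [S [D [folS goodD heightD]]] K cK t t0.
have colP := columns_of_folner_sequence HG eps0 folS goodD heightD.
have coG0 : compact_open_set (G0 s).
  have [_ coC rootlt _ [_ -> _]] := folS.1 0%N.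
  apply: compact_open_bigcup => [|l /= lm]; first exact: finite_II.
  exact: (compact_open_ms (coC l lm) (Ordinal (rootlt l lm)) (Ordinal (rootlt l lm))).
(* The tiling is taken with [d = t / 4], so [e <= t / 4] yields [d + e <= t / 2]; and [e <= 1/4]
   leaves at least three quarters of each tile. *)
pose e := Num.min t 1 / 4; have et : e <= t / 4 /\ e <= 4^-1 /\ 0 < e.
  rewrite /e; have [? ?] : Num.min t 1 <= t /\ Num.min t 1 <= 1.
    by rewrite !ge_min !lexx orbT.
  have : 0 < Num.min t 1 by rewrite lt_min t0 ltr01.
  by split; [lra | split; lra].
have [et4 [e4 e0]] := et.
have [N smallN] : exists N, (1 - e) ^+ N < t / 2.
  have e1 : `|1 - e| < 1 by rewrite ger0_norm; move: e4 e0; clear; lra.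
  have /cvgrPdist_lt/(_ (t / 2)) := cvg_expr e1.
  rewrite divr_gt0 // => /(_ isT)[N _ HN]; exists N.
  have := HN N (leqnn N); rewrite /= sub0r normrN; apply: le_lt_trans; exact: ler_norm.
(* With this value [N eta <= t / 4], so the uncovered mass is below [t / 2 + t / 4 < t]. *)
pose eta := t / (4 * N.+1%:R).
have N0 : 0 < N.+1%:R :> R by [].
have eta0 : 0 < eta by rewrite divr_gt0 // mulr_gt0.
have Neta : N%:R * eta <= t / 4.
  have etaE : eta * (4 * N.+1%:R) = t by rewrite divfK // gt_eqF // mulr_gt0.
  by move: etaE eta0; rewrite -[N.+1%:R]natr1; move: (N%:R : R) eta => n x; nra.
have [||P tilP massP] := tiling_exists HG coG0 (ltW e0) _ eta0 colP N cK (d := t / 4).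
- by lra.
- by rewrite divr_gt0.
have coP := compact_open_covered tilP.
exists (tiling_groupoid P); split.
- exact: (elementary_tiling_groupoid HG tilP).
- move=> u; apply: (folner_tiling_groupoid HG tilP) => //; lra.
move=> mu muP; rewrite (unitspace_tiling_groupoid HG tilP).
rewrite -massE ?lte_fin; last exact: measurable_compact_open.
have massG0 : mass mu (G0 s) = 1 by case: muP => mu1 _; rewrite /mass mu1.
have G0P : G0 s `&` covered P = covered P by apply/setIidPr; exact: (covered_G0 tilP).
have := mass_split mu (measurable_compact_open coG0) (measurable_compact_open coP).
by rewrite massG0 G0P; have := massP mu muP; lra.
Qed.
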